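(* Let $\delta>0$ and let $(X_n)_{n\ge 0}$ be the random walk among biased i.i.d. random conductances (BiRC) with bias $\delta$, defined in the context. Assume that there are $\alpha_\infty,\alpha_0\in[0,+\infty]$ such that $$\lim_{M\to+\infty}\frac{\log\mathbb P(c_0>M)}{\log M}=-\alpha_\infty,\qquad \lim_{\varepsilon\to0^+}\frac{\log\mathbb P(c_0<\varepsilon)}{\log\varepsilon}=\alpha_0,$$ and that $\bar\alpha:=\min(\alpha_0,\alpha_\infty)\le 1$. Assume also that $\mathbb E[\log\rho_0]$ is well defined, where $\rho_0=e^{-2\delta}c_{-1}/c_0$. Then $$\lim_{n\to\infty}\frac{\log X_n}{\log n}=\bar\alpha\qquad \mathbb P\otimes P^\omega\text{-a.s.}$$
   Context: Model (BiRC). Under a probability measure $\mathbb P$ (expectation $\mathbb E$), $\{c_k\}_{k\in\mathbb Z}$ is an i.i.d. sequence of $(0,\infty)$-valued random variables. For $\delta>0$ set $c_k^\delta:=e^{2\delta k}c_k$ (the conductance of the edge $\{k,k+1\}$) and $$\omega_k:=\frac{c_k^\delta}{c_{k-1}^\delta+c_k^\delta},\qquad \rho_k:=\frac{1-\omega_k}{\omega_k}=e^{-2\delta}\frac{c_{k-1}}{c_k},\qquad k\in\mathbb Z.$$ Given the environment $\omega=\{\omega_k\}_{k\in\mathbb Z}$, $(X_n)_{n\ge0}$ is, under the law $P^\omega$, the Markov chain on $\mathbb Z$ with $X_0=0$, $P^\omega(X_{n+1}=i+1\mid X_n=i)=\omega_i$ and $P^\omega(X_{n+1}=i-1\mid X_n=i)=1-\omega_i$.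 ''$\mathbb P\otimes P^\omega$-a.s.'' means: for $\mathbb P$-almost every environment $\omega$, $P^\omega$-almost surely. The convention $\log 0=-\infty$ is used. The expectation $\mathbb E[\log\rho_0]$ is well defined if the positive part or the negative part of $\log\rho_0$ is integrable (it then equals $-2\delta<0$ and the walk is transient to $+\infty$, so that $\log X_n$ makes sense for all large $n$). *)

(* Defs.v *)
From HB Require Import structures.
From mathcomp Require Import all_boot all_order all_algebra.
From mathcomp Require Import all_classical all_reals all_analysis.

Set Implicit Arguments.
Unset Strict Implicit.
Unset Printing Implicit Defensive.

Import Order.TTheory GRing.Theory Num.Theory.
Import numFieldNormedType.Exports.

Local Open Scope classical_set_scope.
Local Open Scope ring_scope.

Section environment.
Context {R : realType}.
Implicit Types (delta : R) (c : int -> R) (k : int).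

                                             
Definition conductance delta c k : R := expR (2 * delta * k%:~R) * c k.

Definition omega delta c k : R :=
  conductance delta c k / (conductance delta c (k - 1) + conductance delta c k).

Definition rho delta c k : R := (1 - omega delta c k) / omega delta c k.

Lemma rhoE delta c k : (forall j, 0 < c j) ->
  rho delta c k = expR (- 2 * delta) * (c (k - 1) / c k).
Proof.
move=> c_gt0; rewrite /rho /omega.
have C_gt0 j : 0 < conductance delta c j by rewrite mulr_gt0 ?expR_gt0.
set a := conductance delta c (k - 1); set b := conductance delta c k.
have a0 : 0 < a by exact: C_gt0.
have b0 : 0 < b by exact: C_gt0.
have -> : (1 - b / (a + b)) / (b / (a + b)) = a / b.
  have ab0 : a + b != 0 by rewrite gt_eqF// addr_gt0.
  have -> : 1 - b / (a + b) = a / (a + b).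
    by rewrite -[X in X - _](divff ab0) -mulrBl addrK.
  by rewrite invf_div mulrA divfK.
have -> : a = expR (- 2 * delta) * expR (2 * delta * k%:~R) * c (k - 1).
  rewrite /a /conductance -expRD; congr (expR _ * _).
  by rewrite intrB mulrBr mulr1 mulNr addrC.
rewrite /b /conductance; set u := expR (2 * delta * k%:~R).
have u0 : u != 0 by rewrite gt_eqF ?expR_gt0.
by rewrite invfM -!mulrA; congr (_ * _); rewrite mulrCA mulVKf.
Qed.

                                                                         
                                                                
Definition step_prob (om : int -> R) (i j : int) : R :=
  if j == i + 1 then om i else if j == i - 1 then 1 - om i else 0.

End environment.

Section probability.
Context {d : measure_display} {T : measurableType d} {R : realType}.
Variable P : probability T R.

                                              
Definition cond_prob (A B : set T) : \bar R := (P (A `&` B) / P B)%E.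

Definition mutually_independent (I : choiceType) (Y : I -> {RV P >-> R}) : Prop :=
  forall (s : seq I) (B : I -> set R), uniq s ->
    (forall i, measurable (B i)) ->
    P (\bigcap_(i in [set` s]) (Y i @^-1` B i)) =
    (\prod_(i <- s) P (Y i @^-1` B i))%E.

Definition identically_distributed (I : Type) (Y : I -> {RV P >-> R}) : Prop :=
  forall (i j : I) (B : set R), measurable B ->
    distribution P (Y i) B = distribution P (Y j) B.

                                                                             
                                                                         
Definition quenched_walk (om : int -> R) (X : nat -> T -> int) : Prop :=
  [/\ forall n (B : set int), measurable (X n @^-1` B),
      P [set t | X 0%N t = 0] = 1%E &
      forall (n : nat) (x : nat -> int) (y : int),
        let past := [set t | forall k, (k <= n)%N -> X k t = x k] in
        (0 < P past)%E ->
        cond_prob [set t | X n.+1 t = y] past = (step_prob om (x n) y)%:E].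

                                                              
Definition expectation_well_defined (Y : T -> R) : Prop :=
  P.-integrable setT (EFin \o Y)^\+%E \/ P.-integrable setT (EFin \o Y)^\-%E.

End probability.

(* Main.v *)
(** Write [C k] for the conductances, [a = min(alpha_0, alpha_oo)], and [T_x]
    for the hitting time of [x].

    Quenched part. The functions [sum_{k >= i} 1 / C k] (harmonic) and
    [sum_{k < i} (1 + 2 sum_{j < k} C j / C k)] (drift one) give a bound on the
    probability of coming back from [2 ^ m.+1] to [2 ^ m] and the bound
    [P(T_x > n) <= sum_{k < x} (1 + 2 sum_{j < k} C j / C k) / n]. Since every
    step crosses the edge [{k, k + 1}] with probability at most [omega k],
    [P(T_x <= n) <= n * min_{0 <= k < x} omega k]. So along [x = 2 ^ m] the walk
    is controlled by the two environment functionals [sum_k sum_j C j / C k] and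
    [min_k omega k].

    Environment. That [ln rho_0] has an expectation forces [ln c_0] to be
    integrable, so [ln c_k = o(k)]. The ratios [c_j / c_k] have finite moments of
    order [s < a <= 1], and [(sum x_i) ^ s <= sum x_i ^ s], so the first
    functional is at most [x ^ (1 / a + o(1))]. Conversely a large [c_{k-1}] and a
    small [c_k] both create a trap of strength [c_{k-1} / c_k]; looking at the
    independent pairs [(c_{2j}, c_{2j+1})] yields [min_k omega k] of order
    [x ^ (- 1 / a + o(1))]. *)

Require Import Defs.
From HB Require Import structures.
From mathcomp Require Import all_boot all_order all_algebra.
From mathcomp Require Import all_classical all_reals all_analysis.
From mathcomp Require Import measurable_realfun.
From mathcomp Require Import ring lra zify.

Set Implicit Arguments.
Unset Strict Implicit.
Unset Printing Implicit Defensive.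

Import Order.TTheory GRing.Theory Num.Theory.
Import numFieldNormedType.Exports.

Local Open Scope classical_set_scope.
Local Open Scope ring_scope.

(** * Supermartingale bounds for nearest-neighbour walks *)

Section histories.
Context {T : Type}.
Variable X : nat -> T -> int.

(** The latest position comes first, so one more step of the walk is one more cons. Histories live
    in the countable type [seq int], which makes every event about them measurable. *)
Fixpoint hist (n : nat) (t : T) : seq int :=
  if n is m.+1 then X n t :: hist m t else [:: X 0 t].

Lemma size_hist n t : size (hist n t) = n.+1.
Proof. by elim: n => //= n ->. Qed.

Lemma nth_hist n t k : (k <= n)%N -> nth 0 (hist n t) k = X (n - k) t.
Proof.
elim: n k => [|n IH] [|k] //=.
by rewrite ltnS subSS; exact: IH.
Qed.

Lemma hist_eqP n t h : size h = n.+1 ->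
  hist n t = h <-> forall k, (k <= n)%N -> X k t = nth 0 h (n - k).
Proof.
move=> sh; split=> [<- k kn|H].
  by rewrite nth_hist ?leq_subr// subKn.
apply: (@eq_from_nth _ 0); rewrite size_hist ?sh// => k; rewrite ltnS => kn.
by rewrite nth_hist// H ?leq_subr// subKn.
Qed.

End histories.

Section paths.
Context {d : measure_display} {T : measurableType d} {R : realType}.
Variables (Q : probability T R) (om : int -> R) (X : nat -> T -> int).
Hypothesis walk : quenched_walk Q om X.

Local Notation hist := (hist X).

(** The event is a countable union, over the codes of sequences, of events fixing the whole path, so
    no condition on [A] arises. *)
Lemma measurable_hist n (A : set (seq int)) : measurable (hist n @^-1` A).
Proof.
have mX : forall n (B : set int), measurable (X n @^-1` B) by case: walk.
have m1 h : measurable (hist n @^-1` [set h]).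
  elim: n h => [|n IH] h /=.
    case: h => [|i [|j h]].
    - by rewrite (_ : _ @^-1` _ = set0)//; apply/seteqP; split.
    - rewrite (_ : _ @^-1` _ = X 0 @^-1` [set i])//.
      by apply/seteqP; split => t /= => [[->]//|->].
    - by rewrite (_ : _ @^-1` _ = set0)//; apply/seteqP; split.
  case: h => [|i h].
    by rewrite (_ : _ @^-1` _ = set0)//; apply/seteqP; split.
  rewrite (_ : _ @^-1` _ = X n.+1 @^-1` [set i] `&` hist n @^-1` [set h]).
    exact: measurableI.
  by apply/seteqP; split => t /= => [[-> ->]//|[-> ->]].
rewrite (_ : _ @^-1` _ = \bigcup_(k in [set: nat])
   [set t | exists2 h, A h & unpickle k = Some h /\ hist n t = h]).
  apply: bigcupT_measurable => k.
  case: (unpickle k) => [h|]; last first.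
    by rewrite (_ : [set _ | _] = set0)//; apply/seteqP; split => t //= [h _ []].
  have [Ah|nAh] := pselect (A h).
    rewrite (_ : [set _ | _] = hist n @^-1` [set h])//.
    apply/seteqP; split => t /= => [[g _ [[<-]]]//|hh].
    by exists h.
  rewrite (_ : [set _ | _] = set0)//; apply/seteqP; split => t //=.
  by move=> [g Ag [[gh]]]; rewrite -gh in Ag.
apply/seteqP; split => t /=.
  by move=> At; exists (pickle (hist n t)) => //=; exists (hist n t); rewrite ?pickleK.
by move=> [k _ [h Ah [_ ->]]].
Qed.

Lemma measurable_walk n (B : set int) : measurable (X n @^-1` B).
Proof. by case: walk => + _ _; exact. Qed.

Local Open Scope ereal_scope.

(** The Markov property in [quenched_walk] concerns pasts of positive probability; on a null past
    both sides vanish, so the product form holds in all cases. *)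
Lemma hist_step n i h (j : int) : size h = n ->
  Q (hist n.+1 @^-1` [set j :: i :: h]) =
  (step_prob om i j)%:E * Q (hist n @^-1` [set i :: h]).
Proof.
move=> sh; have [_ _ Hs] := walk.
pose x k := nth 0%R (i :: h) (n - k).
have pastE : [set t | forall k, (k <= n)%N -> X k t = x k] =
             hist n @^-1` [set i :: h].
  have sh' : size (i :: h) = n.+1 by rewrite /= sh.
  by apply/seteqP; split => t /=; rewrite (hist_eqP X t sh').
have E : hist n.+1 @^-1` [set j :: i :: h] =
    [set t | X n.+1 t = j] `&` hist n @^-1` [set i :: h].
  by apply/seteqP; split => t /= => [[-> ->]//|[-> ->]].
have [q0|q0] := eqVneq (Q (hist n @^-1` [set i :: h])) 0.
  rewrite q0 mule0; apply/eqP; rewrite -measure_le0 -q0 le_measure ?inE//.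
  - exact: measurable_hist.
  - exact: measurable_hist.
  - by rewrite E; exact: subIsetr.
have q1 : 0 < Q (hist n @^-1` [set i :: h]) by rewrite lt0e q0 measure_ge0.
have := Hs n x j; rewrite /= pastE => /(_ q1); rewrite /cond_prob E /x subnn /=.
have fq : Q (hist n @^-1` [set i :: h]) \is a fin_num.
  by apply: fin_num_measure; exact: measurable_hist.
have fp : Q ([set t | X n.+1 t = j] `&` hist n @^-1` [set i :: h]) \is a fin_num.
  apply: fin_num_measure; apply: measurableI; last exact: measurable_hist.
  exact: (measurable_walk n.+1 [set j]).
move: q0 fq fp; case: (Q _) => // q q0 _; case: (Q _) => // p _.
rewrite inver; move: q0; rewrite eqe => q0; rewrite (negbTE q0) -!EFinM => -[<-].
by rewrite mulfVK.
Qed.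

(* Conditionally on each past, [Phi] along the walk is a supermartingale up to
   time [N]; no sign condition on [om] is needed. *)
Lemma supermartingale_bound (N : nat) (Phi : seq int -> R) (A : set (seq int)) :
  (forall i h, (size h < N)%N -> (`|i| <= size h)%N ->
    om i * Phi [:: i + 1, i & h] + (1 - om i) * Phi [:: i - 1, i & h]
      <= Phi (i :: h))%R ->
  (forall i h, size h = N -> (`|i| <= N)%N ->
    0 <= Phi (i :: h) /\ (A (i :: h) -> 1 <= Phi (i :: h)))%R ->
  Q (hist N @^-1` A) <= (Phi [:: 0])%:E.
Proof.
move=> step final.
have mh := measurable_hist.
(* Backward induction on the number [m] of remaining steps: given the history so far, the event has
   conditional probability at most [Phi] of that history. *)
have key m i h : (m + size h)%N = N -> (`|i| <= size h)%N ->
    Q (hist N @^-1` A `&` hist (size h) @^-1` [set i :: h]) <=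
    (Phi (i :: h))%:E * Q (hist (size h) @^-1` [set i :: h]).
  elim: m i h => [|m IH] i h.
    rewrite add0n => sh; rewrite sh => iN; have [P0 P1] := final i h sh iN.
    have [Ah|nAh] := pselect (A (i :: h)).
      rewrite (_ : _ `&` _ = hist N @^-1` [set i :: h]); last first.
        by apply/seteqP; split => t /= => [[]//|e]; rewrite e.
      by rewrite lee_pemull// lee_fin; exact: P1.
    rewrite (_ : _ `&` _ = set0); last first.
      by apply/seteqP; split => t //= [+ e]; rewrite e.
    by rewrite measure0 mule_ge0// lee_fin.
  move=> mN ih; set n := size h.
  have nN : (n < N)%N by rewrite -mN -/n addSn ltnS leq_addl.
  set B := hist n @^-1` [set i :: h].
  pose Bj j := hist n.+1 @^-1` [set j :: i :: h].
  have BE j : Bj j = X n.+1 @^-1` [set j] `&` B.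
    by rewrite /Bj /B; apply/seteqP; split => t /= => [[-> ->]//|[-> ->]].
  have QBj j : Q (Bj j) = (step_prob om i j)%:E * Q B by exact: hist_step.
  have mB : measurable B by exact: mh.
  have mBj j : measurable (Bj j) by exact: mh.
  have fB : Q B \is a fin_num by exact: fin_num_measure.
  have dj : Bj (i + 1)%R `&` Bj (i - 1)%R = set0.
    by apply/seteqP; split => t //=; rewrite /Bj /= => -[-> [ ]]; lia.
  have s1 : step_prob om i (i + 1)%R = om i by rewrite /step_prob eqxx.
  have s2 : step_prob om i (i - 1)%R = (1 - om i)%R.
    by rewrite /step_prob eqxx ifF//; apply/eqP; lia.
  (* The two neighbouring continuations already carry all the mass of [B], so the remainder is
     null. *)
  set U := Bj (i + 1)%R `|` Bj (i - 1)%R.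
  have QU : Q U = Q B.
    transitivity (Q (Bj (i + 1)%R) + Q (Bj (i - 1)%R)); first exact: measureU.
    rewrite !QBj s1 s2 -(fineK fB) -!EFinM -EFinD; congr EFin; ring.
  have UB : U `<=` B by move=> t []; rewrite BE => -[].
  have Q0 : Q (B `\` U) = 0.
    transitivity (Q B - Q (B `&` U)); last by rewrite (setIidr UB) QU subee.
    by apply: measureD => //; [exact: measurableU|rewrite -ge0_fin_numE].
  have -> : hist N @^-1` A `&` B =
      (hist N @^-1` A `&` Bj (i + 1)%R) `|` (hist N @^-1` A `&` Bj (i - 1)%R) `|`
      (hist N @^-1` A `&` (B `\` U)).
    by rewrite -!setIUr -/U setDUK.
  apply: le_trans (_ : Q (hist N @^-1` A `&` Bj (i + 1)%R) +
     Q (hist N @^-1` A `&` Bj (i - 1)%R) + Q (hist N @^-1` A `&` (B `\` U)) <= _).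
    have mI C : measurable C -> measurable (hist N @^-1` A `&` C).
      by move=> mC; apply: measurableI => //; exact: mh.
    have mD : measurable (B `\` U) by apply: measurableD => //; exact: measurableU.
    apply: le_trans (measureU2 _ _ _) _; first by apply: measurableU; exact: mI.
      exact: mI.
    by rewrite leeD2r//; apply: measureU2; exact: mI.
  rewrite [X in _ + X](_ : _ = 0) ?adde0; last first.
    apply/eqP; rewrite -measure_le0 -Q0 le_measure ?inE//.
    - apply: measurableI; first exact: mh.
      by apply: measurableD => //; exact: measurableU.
    - by apply: measurableD => //; exact: measurableU.
  apply: le_trans (leeD (IH (i + 1)%R (i :: h) _ _) (IH (i - 1)%R (i :: h) _ _)) _.
  - by rewrite -mN /= addSnnS.
  - by rewrite /=; lia.
  - by rewrite -mN /= addSnnS.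
  - by rewrite /=; lia.
  rewrite /= -/(Bj (i + 1)%R) -/(Bj (i - 1)%R) !QBj s1 s2 -(fineK fB) -!EFinM -EFinD.
  rewrite lee_fin !mulrA -mulrDl ler_wpM2r ?fine_ge0// mulrC [X in (_ + X <= _)%R]mulrC.
  exact: step.
have X0 : Q (hist 0 @^-1` [set [:: 0%R]]) = 1.
  have [_ <- _] := walk; congr (Q _).
  by apply/seteqP; split => t /= => [[]//|->].
set B := hist 0 @^-1` [set [:: 0%R]] in X0.
have mA : measurable (hist N @^-1` A) by exact: mh.
have mB : measurable B by exact: mh.
have Q0 : Q (hist N @^-1` A `&` ~` B) = 0.
  apply/eqP; rewrite -measure_le0.
  have <- : Q (~` B) = 0 by rewrite probability_setC// X0 subee.
  rewrite le_measure ?inE//; last exact: measurableC.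
  by apply: measurableI => //; exact: measurableC.
have <- : hist N @^-1` A `&` B `|` hist N @^-1` A `&` ~` B = hist N @^-1` A.
  by rewrite -setIUr setUv setIT.
apply: (@le_trans _ _ (Q (hist N @^-1` A `&` B) + Q (hist N @^-1` A `&` ~` B))).
  apply: measureU2; first exact: measurableI.
  by apply: measurableI => //; exact: measurableC.
rewrite Q0 adde0 -[leRHS]mule1 -X0.
exact: key N 0%R [::] (addn0 _) (leqnn _).
Qed.

End paths.

(** * Sums over intervals of integers *)

Section interval_sums.
Context {R : realType}.
Implicit Types (u v : int -> R) (a b : int).

(* Sum of [u k] over [a <= k < b]; a junk value when [b < a]. *)
Definition isum u a b : R := \sum_(m < absz (b - a)%R) u (a + m%:Z).

Lemma isum_nil u a : isum u a a = 0.
Proof. by rewrite /isum subrr big_ord0. Qed.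

Lemma isum_recr u a b : a <= b -> isum u a (b + 1) = isum u a b + u b.
Proof.
move=> ab; rewrite /isum (_ : absz (b + 1 - a)%R = (absz (b - a)%R).+1); last by lia.
by rewrite big_ord_recr /=; congr (_ + u _); lia.
Qed.

Lemma isum_recl u a b : a < b -> isum u a b = u a + isum u (a + 1) b.
Proof.
move=> ab; rewrite /isum (_ : absz (b - a)%R = (absz (b - (a + 1))%R).+1); last by lia.
rewrite big_ord_recl /= addr0; congr (_ + _); apply: eq_bigr => m _.
by rewrite /bump /=; congr (u _); lia.
Qed.

Lemma isum_ge0 u a b : (forall k, 0 <= u k) -> 0 <= isum u a b.
Proof. by move=> u0; apply: sumr_ge0. Qed.

Lemma ler_isum u v a b : (forall k, a <= k -> u k <= v k) ->
  isum u a b <= isum v a b.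
Proof. by move=> uv; apply: ler_sum => m _; apply: uv; lia. Qed.

Lemma isum_cat u (a : int) (n : nat) : a <= 0 ->
  isum u a n%:Z = isum u a 0 + isum u 0 n%:Z.
Proof.
move=> a0; elim: n => [|n IH]; first by rewrite isum_nil addr0.
rewrite -addn1 PoszD !isum_recr ?IH ?addrA//; lia.
Qed.

End interval_sums.

(** * Quenched bounds on hitting times and on backtracking *)

Section hitting_bounds.
Context {d : measure_display} {T : measurableType d} {R : realType}.
Variables (Q : probability T R) (C : int -> R) (X : nat -> T -> int).
Hypothesis C_gt0 : forall k, 0 < C k.
Let om i := C i / (C (i - 1) + C i).
Hypothesis walk : quenched_walk Q om X.

Let om_ge0 i : 0 <= om i.
Proof. by rewrite divr_ge0 ?addr_ge0// ltW. Qed.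

Let om_le1 i : om i <= 1.
Proof. by rewrite ler_pdivrMr ?addr_gt0// mul1r lerDr ltW. Qed.

(** Reaching [x] forces a step from [k] to [k + 1], and each of the [N] steps is such a crossing
    with probability at most [om k]. *)
Lemma hit_early (N : nat) (k x : int) : 0 <= k -> k < x ->
  (Q (hist X N @^-1` [set h | has (fun j => (x <= j)%R) h]) <=
   (N%:R * om k)%:E)%E.
Proof.
move=> k0 kx.
(* A history after [n] steps has size [n.+1], so [N.+1 - size h] counts the steps still to come.
   Once [k] has been passed the trivial bound [1] takes over. *)
pose Phi h : R := if all (fun j => (j <= k)%R) h
                  then (N.+1 - size h)%:R * om k else 1.
have -> : N%:R * om k = Phi [:: 0] by rewrite /Phi /= k0 subSS subn0.
apply: (supermartingale_bound walk) => [i h hN _|i h hN iN]; last first.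
  rewrite {1}/Phi; split.
    by case: ifP => // _; rewrite mulr_ge0.
  move=> /hasP[j jh xj]; rewrite /Phi ifN//.
  by apply/allPn; exists j => //; lia.
rewrite /Phi /= !subSS -/om; case: (boolP (i <= k)) => ik; last first.
  by rewrite !andbF !mulr1 addrC subrK.
rewrite (_ : i - 1 <= k) /=; last by lia.
case: (boolP (all _ h)) => ah; last by rewrite andbF !mulr1 addrC subrK.
rewrite andbT.
have hN1 : (N - size h = (N - (size h).+1).+1)%N by lia.
rewrite hN1; set n := (N - _.+1)%N.
have := om_ge0 k; have := om_le1 k; have := om_ge0 i; have := om_le1 i.
have n0 : 0 <= n%:R :> R by [].
case: ifPn => ik1 *; first by rewrite -natr1; nra.
have -> : i = k by lia.
rewrite -natr1; have : 0 <= om k * (n%:R * om k).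
  by apply: mulr_ge0 => //; apply: mulr_ge0.
by nra.
Qed.

(** Markov's inequality for the hitting time of [x]: the expected remaining time [isum g i x] plus
    the elapsed time is a supermartingale until [x] is hit. The conductances can be cut at [- N.+1]
    because [N] steps do not lead that far. *)
Lemma hit_late (N : nat) (x : int) : 0 < x -> (0 < N)%N ->
  (Q (hist X N @^-1` [set h | all (fun j => (j < x)%R) h]) <=
   (isum (fun k => 1 + 2 * (isum C (- N.+1%:Z) k / C k)) 0 x / N%:R)%:E)%E.
Proof.
move=> x0 N0.
set g := fun k : int => _.
pose Phi h : R := if all (fun j => (j < x)%R) h
                  then (isum g (head 0 h) x + (size h).-1%:R) / N%:R else 0.
have N0' : 0 < N%:R :> R by rewrite ltr0n.
have g_ge0 k : 0 <= g k.
  rewrite /g addr_ge0// mulr_ge0// divr_ge0//; last exact/ltW.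
  by apply: isum_ge0 => j; exact/ltW.
have -> : isum g 0 x / N%:R = Phi [:: 0] by rewrite /Phi /= x0 addr0.
apply: (supermartingale_bound walk) => [i h hN ih|i h hN iN]; last first.
  rewrite /Phi; split.
    by case: ifP => // _; rewrite divr_ge0// addr_ge0// isum_ge0.
  move=> /= ->; rewrite hN ler_pdivlMr// mul1r lerDr.
  exact: isum_ge0.
rewrite /Phi /= -/om; case: (boolP (i < x)) => ix; last by rewrite !andbF !mulr0 addr0.
rewrite (_ : i - 1 < x) /=; last by lia.
case: (boolP (all _ h)) => ah; last by rewrite andbF !mulr0 addr0.
rewrite andbT.
have E1 : isum g (i - 1) x = g (i - 1) + isum g i x.
  by rewrite isum_recl ?subrK//; lia.
have E2 : isum g i x = g i + isum g (i + 1) x by rewrite isum_recl.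
have E3 : isum C (- N.+1%:Z) i = isum C (- N.+1%:Z) (i - 1) + C (i - 1).
  by rewrite -[in LHS](subrK 1 i) isum_recr//; lia.
(* First-step analysis: crossing from [i] takes one step and, if it goes left, a crossing from
   [i - 1] followed by a new attempt. *)
have key : om i * g i = 1 + (1 - om i) * g (i - 1).
  have := C_gt0 i; have := C_gt0 (i - 1).
  rewrite /om /g E3; set S := isum _ _ _ => c1 c2; field.
  by rewrite !gt_eqF// addr_gt0.
(* When [i + 1 = x] the walk has arrived and [Phi] drops to zero, below the nonnegative value put in
   its place. *)
apply: (@le_trans _ _ ((om i * (isum g (i + 1) x + (size h).+1%:R) +
   (1 - om i) * (isum g (i - 1) x + (size h).+1%:R)) / N%:R)).
  rewrite [leRHS]mulrDl -[X in _ <= _ + X]mulrA -[X in _ <= X + _]mulrA lerD2r ler_wpM2l//.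
  by case: ifP => // _; rewrite divr_ge0// addr_ge0// isum_ge0.
rewrite ler_pM2r ?invr_gt0// E1 E2 -natr1.
move: (isum g (i + 1) x) (size h)%:R key => S n key.
rewrite -subr_ge0 [leRHS](_ : _ = (om i * g i) - (1 - om i) * g (i - 1) - 1); last by ring.
by rewrite key; lra.
Qed.

(** The tail [h'] is the past of the position [i], so the visit beyond [x] precedes the one at or
    below [y]. *)
Fixpoint returned (x y : int) (h : seq int) : bool :=
  if h is i :: h' then
    returned x y h' || (has (fun j => (x <= j)%R) h' && (i <= y))
  else false.

(** The tail resistance [H] is harmonic and vanishes at [N.+1], out of reach in [N] steps, so
    falling from [x] to [y] has probability at most [H x / H y]. Keeping only the first term of
    [H y] gives the factor [C y]. *)
Lemma backtrack (N : nat) (x y : int) : 0 < x -> y < x -> x <= N.+1%:Z ->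
  (Q (hist X N @^-1` [set h | returned x y h]) <=
   (C y * isum (fun k => (C k)^-1) x N.+1)%:E)%E.
Proof.
move=> x0 yx xN.
set u := fun k : int => (C k)^-1.
have u0 k : 0 < u k by rewrite invr_gt0.
pose H i : R := isum u i N.+1%:Z.
have H0 i : 0 <= H i by apply: isum_ge0 => k; exact/ltW.
have HE i : i < N.+1%:Z -> H i = u i + H (i + 1) by exact: isum_recl.
have Hy : 0 < H y.
  by rewrite HE ?(lt_le_trans yx)// ltr_wpDr.
(* Three phases: after a return, between the first visit beyond [x] and a return, and before that
   visit. The harmonic function moves only in the second phase. *)
pose Phi h : R := if returned x y h then 1
  else if has (fun j => (x <= j)%R) h then H (head 0 h) / H y
  else H x / H y.
have P0 h : 0 <= Phi h.
  by rewrite /Phi; case: ifP => // _; case: ifP => _; rewrite divr_ge0// ltW.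
apply: (@le_trans _ _ (Phi [:: 0])%:E); last first.
  rewrite lee_fin /Phi /= orbF (_ : x <= 0 = false); last by apply/negbTE; rewrite -ltNge.
  rewrite mulrC ler_wpM2r ?H0//.
  rewrite -[leRHS]invrK lef_pV2 ?posrE ?invr_gt0// HE ?(lt_le_trans yx)//.
  by rewrite lerDl.
apply: (supermartingale_bound walk) => [i h hN ih|i h hN iN]; last first.
  by split => // rh; rewrite /Phi rh.
have harm : om i * H (i + 1) + (1 - om i) * H (i - 1) = H i.
  rewrite [H (i - 1)]HE; last by lia.
  rewrite subrK [H i]HE; last by lia.
  have := C_gt0 i; have := C_gt0 (i - 1).
  rewrite /om /u; set S := H _ => c1 c2; field.
  by rewrite !gt_eqF// addr_gt0.
rewrite /Phi -/om.
case: (boolP (returned x y (i :: h))) => [/= ->|].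
  by rewrite !mulr1 addrC subrK.
move=> /= nr; rewrite (negbTE nr) /=.
case: (boolP ((x <= i) || has (fun j : int => x <= j) h)) => hx /=; last first.
  move: hx; rewrite negb_or => /andP[xi hx]; rewrite !orbF.
  rewrite (_ : x <= i - 1 = false); last by lia.
  case: (boolP (x <= i + 1)) => ix.
    rewrite (_ : i + 1 = x); last by lia.
    by rewrite -mulrDl addrC subrK mul1r.
  by rewrite -mulrDl addrC subrK mul1r.
have iy : y < i.
  move: hx nr => /orP[|hx]; first by lia.
  by rewrite hx /= negb_or => /andP[_]; lia.
rewrite !orbT (_ : i + 1 <= y = false); last by lia.
rewrite -harm [leRHS]mulrDl -!mulrA lerD2l; case: (boolP (i - 1 <= y)) => // iy1.
rewrite (_ : i - 1 = y); last by lia.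
by rewrite divff// gt_eqF.
Qed.

End hitting_bounds.

(** * Borel-Cantelli *)

Section summability.
Context {R : realType}.
Implicit Types (u : nat -> \bar R) (K r : R).

Lemma geometric_sum_le r n : 0 <= r -> r < 1 ->
  \sum_(i < n) r ^+ i <= (1 - r)^-1.
Proof.
move=> r0 r1; have r1' : 0 < 1 - r by rewrite subr_gt0.
rewrite -[leRHS]mul1r ler_pdivlMr// mulrC -opprB mulNr -subrX1 opprB.
by rewrite lerBlDr lerDl exprn_ge0.
Qed.

Local Open Scope ereal_scope.

Lemma nneseries_le_bound u (M : \bar R) : (forall n, 0 <= u n) ->
  (forall n, \sum_(i < n) u i <= M) -> \sum_(n <oo) u n <= M.
Proof.
move=> u0 uM; apply: lime_le; first by apply: is_cvg_nneseries => n _ _.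
by apply: nearW => n; rewrite big_mkord.
Qed.

Lemma nneseries_geometric u K r : (0 <= K)%R -> (0 <= r)%R -> (r < 1)%R ->
  (forall n, 0 <= u n) -> (forall n, u n <= (K * r ^+ n)%:E) ->
  \sum_(n <oo) u n <= (K / (1 - r))%:E.
Proof.
move=> K0 r0 r1 u0 uK; apply: nneseries_le_bound => // n.
apply: (@le_trans _ _ (\sum_(i < n) (K * r ^+ i)%:E)); first exact: lee_sum.
by rewrite sumEFin lee_fin -mulr_sumr ler_wpM2l// geometric_sum_le.
Qed.

End summability.

Section borel_cantelli.
Context {d : measure_display} {T : measurableType d} {R : realType}.
Variable mu : {measure set T -> \bar R}.
Implicit Type E : nat -> set T.
Local Open Scope ereal_scope.

Lemma ae_eventually_notin E : (forall n, measurable (E n)) ->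
  \sum_(n <oo) mu (E n) < +oo -> {ae mu, forall t, \forall n \near \oo, ~ E n t}.
Proof.
move=> mE sE; exists (lim_sup_set E); split.
- apply: bigcapT_measurable => n; apply: bigcup_measurable => k _; exact: mE.
- exact: lim_sup_set_cvg0.
- move=> t /= nE n _; apply: contrapT => nEt; apply: nE.
  exists n => // k /= nk Ekt; apply: nEt; by exists k.
Qed.

Lemma ae_eventually_notin_geometric E (K r : R) : (forall n, measurable (E n)) ->
  (0 <= r)%R -> (r < 1)%R -> (\forall n \near \oo, mu (E n) <= (K * r ^+ n)%:E) ->
  {ae mu, forall t, \forall n \near \oo, ~ E n t}.
Proof.
move=> mE r0 r1 [n0 _ En0].
have K0 : (0 <= `|K|)%R by [].
have : {ae mu, forall t, \forall n \near \oo, ~ E (n + n0)%N t}.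
  apply: ae_eventually_notin => // ; apply: le_lt_trans (ltry (`|K| / (1 - r))).
  apply: nneseries_geometric => // n.
  apply: le_trans (En0 _ (leq_addl _ _)) _; rewrite lee_fin.
  rewrite (le_trans (ler_wpM2r _ (ler_norm K))) ?exprn_ge0// ler_wpM2l// exprD.
  by rewrite ler_piMr ?exprn_ge0// exprn_ile1// ltW.
apply: filterS => t [n1 _ H]; exists (n1 + n0)%N => // n /= nn.
have := H (n - n0)%N; rewrite /= subnK ?leq_subRL; last by rewrite (leq_trans _ nn)// leq_addl.
  by apply; rewrite addnC.
by rewrite (leq_trans _ nn)// leq_addl.
Qed.

Lemma ae_and (A B : T -> Prop) : {ae mu, forall t, A t} ->
  {ae mu, forall t, B t} -> {ae mu, forall t, A t /\ B t}.
Proof. exact: filterI. Qed.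

Lemma ae_forall_countable (I : countType) (S : I -> T -> Prop) :
  (forall i, {ae mu, forall t, S i t}) -> {ae mu, forall t, forall i, S i t}.
Proof.
move=> aeS.
have : {ae mu, forall t, forall n i, unpickle n = Some i -> S i t}.
  apply: ae_foralln => n; case: (unpickle n) => [i|]; last exact: aeW.
  by apply: filterS (aeS i) => t St _ [<-].
by apply: filterS => t H i; apply: (H (pickle i)); exact: pickleK.
Qed.

End borel_cantelli.

(** * The walk in a fixed environment *)

Section environment_conditions.
Context {R : realType}.
Implicit Types (delta b : R) (c : int -> R).

(** The slope [delta / 2] is small against the bias [2 * delta]: conductances keep growing
    exponentially, at rates between [3/2 delta] and [5/2 delta] on the right half-line. *)
Definition subexponential delta c :=
  exists K, forall k, `|ln (c k)| <= K + delta / 2 * `|k|%:~R.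

(* Quenched expected time to go from [k] to [k + 1] for the walk reflected at
   [- M]. *)
Definition crossing_time delta c (M : nat) (k : int) : R :=
  1 + 2 * (isum (conductance delta c) (- M%:Z) k / conductance delta c k).

(** For [x = 2 ^ m] the exponential is [x ^ (1 / b)]. The constant is uniform in [M], since
    [hit_late] moves the reflection point with the time horizon. *)
Definition fast_crossing delta c b :=
  exists K, forall m M, isum (crossing_time delta c M) 0 (2 ^ m)%N%:Z <=
    K * expR (m%:R * (ln 2 / b)).

Definition has_traps delta c b :=
  exists K, \forall m \near \oo, exists k,
    [/\ 0 <= k, k < (2 ^ m)%N%:Z & omega delta c k <= K * expR (- (m%:R * (ln 2 / b)))].

End environment_conditions.

(** * Resistances and crossing times in subexponential environments *)

Section subexponential_environment.
Context {R : realType}.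
Variables (delta : R) (c : int -> R).
Hypothesis delta_gt0 : 0 < delta.
Hypothesis c_gt0 : forall k, 0 < c k.
Local Notation C := (conductance delta c).

Lemma conductance_gt0 k : 0 < C k.
Proof. by rewrite mulr_gt0 ?expR_gt0. Qed.

Let norm_nat (k : nat) : `|k%:Z|%:~R = k%:R :> R.
Proof. by rewrite ger0_norm. Qed.

(** At [y = 2 ^ m] the conductance is at most of order [exp (5/2 delta y)] and the resistance beyond
    [2 y] at most of order [exp (- 3 delta y)]. The product is of order [exp (- delta y / 2)], and
    [y >= m]. *)
Lemma return_weight_bound : subexponential delta c ->
  exists K, forall m M, C (2 ^ m)%N%:Z *
    isum (fun k => (C k)^-1) (2 ^ m.+1)%N%:Z M <= K * expR (- (delta / 2)) ^+ m.
Proof.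
move=> [K HK].
have up (k : nat) : C k%:Z <= expR K * expR (5 / 2 * delta * k%:R).
  have := HK k%:Z; rewrite norm_nat /conductance -pmulrn => /ler_normlP[_ h].
  by rewrite -[c k%:Z]lnK ?posrE// -!expRD ler_expR; lra.
have lo (k : nat) : (C k%:Z)^-1 <= expR K * expR (- (3 / 2 * delta) * k%:R).
  have := HK k%:Z; rewrite norm_nat /conductance -pmulrn => /ler_normlP[h _].
  by rewrite -[c k%:Z]lnK ?posrE// -!expRD -expRN ler_expR; lra.
set q := expR (- (3 / 2 * delta)) : R.
have q0 : 0 <= q by exact: expR_ge0.
have q1 : q < 1 by rewrite expR_lt1 oppr_lt0 mulr_gt0.
exists (expR K * expR K / (1 - q)) => m M; set y := (2 ^ m)%N.
have -> : (2 ^ m.+1)%N = (y * 2)%N by rewrite expnSr.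
have tail : isum (fun k => (C k)^-1) (y * 2)%N%:Z M <=
    expR K * expR (- (3 / 2 * delta) * (y * 2)%:R) / (1 - q).
  set z := expR K * _.
  apply: (@le_trans _ _ (z * \sum_(j < absz (M - (y * 2)%N%:Z)%R) q ^+ j)).
    rewrite mulr_sumr; apply: ler_sum => j _; rewrite -PoszD.
    by apply: le_trans (lo _) _; rewrite natrD mulrDr expRD mulrA ler_wpM2l// expRM_natr.
  by rewrite ler_wpM2l ?mulr_ge0 ?expR_ge0// geometric_sum_le.
apply: le_trans (ler_pM _ _ (up y) tail) _.
- exact/ltW/conductance_gt0.
- by apply: isum_ge0 => k; rewrite invr_ge0; exact/ltW/conductance_gt0.
rewrite !mulrA [leRHS]mulrAC ler_pM2r ?invr_gt0 ?subr_gt0//.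
rewrite -expRM_natr -!expRD ler_expR.
have my : m%:R <= y%:R :> R by rewrite ler_nat ltnW// ltn_expl.
rewrite natrM; have := ler_wpM2l (ltW delta_gt0) my; lra.
Qed.

(** The conductances left of the origin are summable, so the position of the reflection point
    affects these finitely many crossing times by a bounded amount. *)
Lemma crossing_sum_bounded (n : nat) : subexponential delta c ->
  exists K, forall M, isum (crossing_time delta c M) 0 n <= K.
Proof.
move=> [K HK].
have lo (j : nat) : C (- j.+1%:Z) <= expR K * expR (- (3 / 2 * delta)) ^+ j.
  have := HK (- j.+1%:Z); rewrite normrN norm_nat /conductance => /ler_normlP[_].
  rewrite -[c _]lnK ?posrE// -expRM_natr -!expRD ler_expR lnK ?posrE//.
  rewrite mulrNz -pmulrn -[j.+1%:R]natr1.
  by have := mulr_ge0 (ltW delta_gt0) (ler0n R j); have := delta_gt0; lra.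
set q := expR (- (3 / 2 * delta)) : R in lo.
have q0 : 0 <= q by exact: expR_ge0.
have q1 : q < 1 by rewrite expR_lt1 oppr_lt0 mulr_gt0.
have neg (M : nat) : isum C (- M%:Z) 0 <= expR K / (1 - q).
  apply: (@le_trans _ _ (expR K * \sum_(j < M) q ^+ j)); last first.
    by rewrite ler_wpM2l ?expR_ge0// geometric_sum_le.
  elim: M => [|M IH]; first by rewrite oppr0 isum_nil big_ord0 mulr0.
  rewrite isum_recl; last by lia.
  rewrite big_ord_recr mulrDr addrC; apply: lerD; last exact: lo.
  by rewrite (_ : - M.+1%:Z + 1 = - M%:Z)//; lia.
exists (isum (fun k => 1 + 2 * ((expR K / (1 - q) + isum C 0 k) / C k)) 0 n) => M.
apply: ler_isum => k k0; rewrite /crossing_time lerD2l ler_wpM2l//.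
rewrite ler_pM2r ?invr_gt0 ?conductance_gt0//.
have -> : k = `|k|%N%:Z by lia.
by rewrite isum_cat ?lerD2r ?neg//; lia.
Qed.

End subexponential_environment.

(** * Almost sure behaviour of the walk at dyadic levels *)

Section quenched.
Context {d : measure_display} {T : measurableType d} {R : realType}.
Variables (Q : probability T R) (delta : R) (c : int -> R) (X : nat -> T -> int).
Hypothesis delta_gt0 : 0 < delta.
Hypothesis c_gt0 : forall k, 0 < c k.
Hypothesis walk : quenched_walk Q (omega delta c) X.

Let C_gt0 := conductance_gt0 delta c_gt0.

(** Integer part of [(2 ^ m) ^ (1 / b)], the time at which a walk growing like [n ^ b] arrives at
    level [2 ^ m]. *)
Let time b m := Num.truncn (expR (m%:R * (ln 2 / b)) : R).

Let ln2_gt0 : 0 < ln 2 :> R. Proof. by rewrite ln_gt0// ltr1n. Qed.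

Let time_le b m : (time b m)%:R <= expR (m%:R * (ln 2 / b)) :> R.
Proof. by rewrite truncn_le expR_ge0. Qed.

Let time_ge b m : 0 < b -> expR (m%:R * (ln 2 / b)) <= 2 * (time b m)%:R :> R.
Proof.
move=> b0.
have e1 : 1 <= expR (m%:R * (ln 2 / b)) :> R.
  by rewrite leNgt expR_lt1 -leNgt mulr_ge0// divr_ge0 ?ltW.
have t1 : 1 <= (time b m)%:R :> R by rewrite ler1n truncn_gt0.
have := truncnS_gt (expR (m%:R * (ln 2 / b)) : R); rewrite -/(time b m) -natr1.
by lra.
Qed.

(** The bound on the mean hitting time is of order [2 ^ (m / b)] and the time allowed is about
    [2 ^ (m / b')] with [b' < b], so by [hit_late] the failure probabilities decay geometrically. *)
Lemma ae_fast b b' : 0 < b' -> b' < b -> fast_crossing delta c b ->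
  {ae Q, forall t, \forall m \near \oo,
    ~ all (fun j => j < (2 ^ m)%N%:Z) (hist X (time b' m) t)}.
Proof.
move=> b'0 bb [K HK]; have b0 : 0 < b by exact: lt_trans bb.
pose r : R := expR (ln 2 / b - ln 2 / b').
apply: (ae_eventually_notin_geometric (K := 2 * `|K|) (r := r)).
- move=> m; exact: (measurable_hist walk _
    [set h | all (fun j => j < (2 ^ m)%N%:Z) h]).
- exact: expR_ge0.
- by rewrite expR_lt1 subr_lt0 ltr_pM2l// ltf_pV2.
apply: nearW => m.
have t0 : 0 < (time b' m)%:R :> R.
  have := time_ge m b'0; have := expR_gt0 (m%:R * (ln 2 / b') : R); lra.
have t0' : (0 < time b' m)%N by rewrite ltr0n in t0.
apply: le_trans (hit_late C_gt0 walk (x := (2 ^ m)%N%:Z) _ t0') _.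
  by rewrite ltz_nat expn_gt0.
rewrite lee_fin ler_pdivrMr//; apply: le_trans (HK m _) _.
apply: le_trans (ler_wpM2r (expR_ge0 _) (ler_norm K)) _.
rewrite [leRHS](_ : _ = `|K| * (r ^+ m * (2 * (time b' m)%:R))); last by ring.
rewrite ler_wpM2l//.
apply: le_trans _ (ler_wpM2l _ (time_ge m b'0)); last by rewrite exprn_ge0 ?expR_ge0.
by rewrite -expRM_natl -expRD ler_expR; lra.
Qed.

(** By [hit_early] at a trap, at most [2 ^ (m / b')] attempts are made at an edge crossed with
    probability of order at most [2 ^ (- m / b)]. *)
Lemma ae_slow b b' : 0 < b -> b < b' -> has_traps delta c b ->
  {ae Q, forall t, \forall m \near \oo,
    ~ has (fun j => (2 ^ m)%N%:Z <= j) (hist X (time b' m) t)}.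
Proof.
move=> b0 bb [K HK]; have b'0 : 0 < b' by exact: lt_trans bb.
pose r : R := expR (ln 2 / b' - ln 2 / b).
apply: (ae_eventually_notin_geometric (K := K) (r := r)).
- move=> m; exact: (measurable_hist walk _
    [set h | has (fun j => (2 ^ m)%N%:Z <= j) h]).
- exact: expR_ge0.
- by rewrite expR_lt1 subr_lt0 ltr_pM2l// ltf_pV2.
near=> m.
have [k [k0 km ok]] : exists k, [/\ 0 <= k, k < (2 ^ m)%N%:Z &
    omega delta c k <= K * expR (- (m%:R * (ln 2 / b)))] by near: m.
apply: le_trans (hit_early C_gt0 walk (time b' m) k0 km) _; rewrite lee_fin.
have om0 : 0 <= omega delta c k by rewrite divr_ge0 ?addr_ge0// ltW// C_gt0.
apply: le_trans (ler_pM _ om0 (time_le b' m) ok) _ => //.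
by rewrite mulrCA -expRD -expRM_natl mulrBr.
Unshelve. all: by end_near. Qed.

Lemma returned_hist_mono x y n m t : (n <= m)%N ->
  returned x y (hist X n t) -> returned x y (hist X m t).
Proof.
by move=> /subnK <-; elim: (m - n)%N => // k IH /IH /= ->.
Qed.

(** The bound of [backtrack] is uniform in the horizon [N], hence passes to the increasing union
    over [N]; by [return_weight_bound] it is geometric in [m]. *)
Lemma ae_no_return : subexponential delta c ->
  {ae Q, forall t, \forall m \near \oo, forall N,
    ~ returned (2 ^ m.+1)%N (2 ^ m)%N (hist X N t)}.
Proof.
move=> /(return_weight_bound delta_gt0 c_gt0) [K HK].
pose F m N := hist X N @^-1` [set h | returned (2 ^ m.+1)%N (2 ^ m)%N h].
have mF m N : measurable (F m N) by exact: (measurable_hist walk).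
have : {ae Q, forall t, \forall m \near \oo, ~ (\bigcup_N F m N) t}.
  apply: (ae_eventually_notin_geometric (K := K) (r := expR (- (delta / 2)))).
  - by move=> m; exact: bigcupT_measurable.
  - exact: expR_ge0.
  - by rewrite expR_lt1 oppr_lt0 divr_gt0.
  apply: nearW => m.
  suff H : (Q (\bigcup_N F m N) <= (K * expR (- (delta / 2)) ^+ m)%:E)%E by exact: H.
  have cv : Q \o F m @ \oo --> Q (\bigcup_N F m N).
    apply: nondecreasing_cvg_mu => //; first exact: bigcupT_measurable.
    move=> n n' nn; apply/subsetPset => t; exact: returned_hist_mono.
  have -> : Q (\bigcup_N F m N) = limn (Q \o F m) by apply/esym/cvg_lim.
  apply: lime_le; first by apply/cvg_ex; eexists; exact: cv.
  near=> N; have xN : (2 ^ m.+1 <= N)%N by near: N; exact: nbhs_infty_ge.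
  apply: le_trans (backtrack C_gt0 walk (N := N) _ _ _) _.
  - by rewrite ltz_nat expn_gt0.
  - by rewrite ltz_nat ltn_exp2l.
  - by rewrite lez_nat (leq_trans xN).
  by rewrite lee_fin.
apply: filterS => t; apply: filterS => m nF N rN; apply: nF.
by exists N.
Unshelve. all: by end_near. Qed.

(** At a fixed level the numerator in [hit_late] stays bounded, so staying below the level up to
    time [N] has probability at most [K / N]. *)
Lemma ae_hits : subexponential delta c ->
  {ae Q, forall t, forall m : nat, exists N,
    ~ all (fun j => j < (2 ^ m)%N%:Z) (hist X N t)}.
Proof.
move=> /(crossing_sum_bounded delta_gt0 c_gt0) sub; apply: ae_foralln => m.
have [K HK] := sub (2 ^ m)%N.
pose F N := hist X N @^-1` [set h | all (fun j => j < (2 ^ m)%N%:Z) h].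
have mF N : measurable (F N) by exact: (measurable_hist walk).
exists (\bigcap_N F N); split.
- exact: bigcapT_measurable.
- apply/eqP; rewrite -measure_le0; apply/lee_addgt0Pr => e e0; rewrite add0e.
  pose N := (Num.truncn (`|K| / e)).+1.
  apply: (@le_trans _ _ (Q (F N))).
    by rewrite le_measure ?inE//; [exact: bigcapT_measurable|exact: bigcap_inf].
  apply: le_trans (hit_late C_gt0 walk _ _) _ => //.
    by rewrite ltz_nat expn_gt0.
  rewrite lee_fin ler_pdivrMr//; apply: le_trans (HK _) _.
  apply: le_trans (ler_norm K) _; rewrite mulrC -ler_pdivrMr//.
  by apply/ltW; exact: truncnS_gt.
- move=> t /= nex N _; apply: contrapT => nF; apply: nex.
  by exists N.
Qed.

(** [Phi = 0] suffices: the final condition of [supermartingale_bound] is asked only at positions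
    with [|i| <= N]. This speed limit gives the upper bound when the exponent is [1]. *)
Lemma ae_linear : {ae Q, forall t, forall n : nat, X n t <= n%:Z}.
Proof.
apply: ae_foralln => n.
exists (X n @^-1` [set j | ~ (j <= n%:Z)%R]); split.
- exact: (measurable_walk walk).
- apply/eqP; rewrite -measure_le0.
  have := @supermartingale_bound _ _ _ _ _ _ walk n (cst 0)
     [set h | ~ (head 0 h <= n%:Z)%R].
  rewrite /= => /(_ _ _)/(le_trans _) -> //.
  - have hE t : head 0 (hist X n t) = X n t by case: n.
    apply: le_measure; rewrite ?inE//.
    + exact: (measurable_walk walk).
    + exact: (measurable_hist walk).
    + by move=> t /=; rewrite hE.
  - by move=> i h _ _; rewrite !mulr0 addr0.
  - by move=> i h _ iN; split => // ; lia.
- by move=> t.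
Qed.

End quenched.

(** * From dyadic levels to all times *)

Section growth.
Context {T : Type}.
Variables (X : nat -> T -> int) (t : T).

Lemma all_hist_mono (p : pred int) n m : (n <= m)%N ->
  all p (hist X m t) -> all p (hist X n t).
Proof.
move=> /subnK <-; elim: (m - n)%N => // k IH.
by rewrite addSn /= => /andP[_]; exact: IH.
Qed.

(** If [X n t <= y], the visit beyond [x] took place strictly before time [n], and time [n]
    completes a return. *)
Lemma no_return_gt (x y : int) n N : y < x -> (N <= n)%N ->
  ~ returned x y (hist X n t) -> ~ all (fun j => j < x) (hist X N t) ->
  y < X n t.
Proof.
move=> yx Nn nr nall; rewrite ltNge; apply/negP => Xy; apply: nr.
have {nall} : ~ all (fun j => j < x) (hist X n t).
  by move=> h; apply: nall; exact: all_hist_mono h.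
have -> : returned x y (hist X n t) = returned x y (hist X n.-1 t) && (0 < n)%N
    || (has (fun j => x <= j) (hist X n.-1 t) && (0 < n)%N && (X n t <= y)).
  by case: (n) => [|n'] /=; rewrite ?andbF ?andbT.
case: n {Nn} Xy => [|n] Xy /=.
  by case; rewrite andbT (le_lt_trans Xy).
rewrite Xy !andbT => /negP; rewrite (le_lt_trans Xy yx)/= -has_predC => /hasP[j jh /= xj].
apply/orP; right; apply/hasP; exists j => //.
by rewrite leNgt.
Qed.

Lemma eventually_ge1 :
  (\forall m \near \oo, forall N, ~ returned (2 ^ m.+1)%N (2 ^ m)%N (hist X N t)) ->
  (forall m : nat, exists N, ~ all (fun j => j < (2 ^ m)%N%:Z) (hist X N t)) ->
  \forall n \near \oo, (1 <= X n t).
Proof.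
move=> [m _ /(_ m (leqnn _)) nr] /(_ m.+1)[N hN].
near=> n; have Nn : (N <= n)%N by near: n; exact: nbhs_infty_ge.
have : (2 ^ m)%N%:Z < X n t.
  by apply: no_return_gt (nr n) hN => //; rewrite ltz_nat ltn_exp2l.
by lia.
Unshelve. all: by end_near. Qed.

Context {R : realType}.
Let ln2_gt0 : 0 < ln 2 :> R. Proof. by rewrite ln_gt0// ltr1n. Qed.

(** Take [p] with [2 ^ p <= n ^ b < 2 ^ p.+1]. Level [2 ^ p] is reached by time [n] and the walk
    does not fall back to [2 ^ p.-1]; the rounding and the fall cost one [ln 2] each. *)
Lemma growth_ge (b : R) : 0 < b ->
  (\forall m \near \oo, forall N, ~ returned (2 ^ m.+1)%N (2 ^ m)%N (hist X N t)) ->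
  (\forall m \near \oo, ~ all (fun j => j < (2 ^ m)%N%:Z)
    (hist X (Num.truncn (expR (m%:R * (ln 2 / b)))) t)) ->
  \forall n \near \oo, b * ln (n%:R : R) <= ln ((X n t)%:~R : R) + 2 * ln 2.
Proof.
move=> b0 [m1 _ nr] [m2 _ fast].
(* The successor allows the no-return property to be used at [p.-1]. *)
pose m0 := (maxn m1 m2).+1.
near=> n.
have n0 : expR (m0%:R * (ln 2 / b)) <= n%:R :> R by near: n; exact: nbhs_infty_ger.
have n1 : 1 <= n%:R :> R by near: n; exact: nbhs_infty_ger.
have n1' : 0 < n%:R :> R := lt_le_trans ltr01 n1.
have bn0 : 0 <= b * ln (n%:R : R) / ln 2.
  by apply: divr_ge0 (ltW ln2_gt0); apply: mulr_ge0 (ltW b0) (ln_ge0 n1).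
set p := Num.truncn (b * ln (n%:R : R) / ln 2).
have m0p : (m0 <= p)%N.
  rewrite truncn_ge_nat// ler_pdivlMr// -ler_pdivrMl// -ler_expR lnK ?posrE//.
  by apply: le_trans n0; rewrite ler_expR; lra.
have pE : (p.-1.+1 = p) by move: m0p; rewrite /m0; lia.
have := truncn_itv bn0; rewrite -/p ltr_pdivrMr// ler_pdivlMr// => /andP[ple plt].
have timen : (Num.truncn (expR (p%:R * (ln 2 / b)) : R) <= n)%N.
  rewrite truncn_le_nat (@le_lt_trans _ _ n%:R) ?ltr_nat//.
  rewrite -[n%:R in leRHS]lnK ?posrE// ler_expR mulrA ler_pdivrMr// mulrC.
  by rewrite [leRHS]mulrC mulrC.
have nrp : ~ returned (2 ^ p)%N (2 ^ p.-1)%N (hist X n t).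
  by have := nr p.-1 _ n; rewrite pE; apply; rewrite /=; move: m0p; rewrite /m0; lia.
have fastp := fast p _.
have : (2 ^ p.-1)%N%:Z < X n t.
  apply: no_return_gt timen nrp (fastp _); last by rewrite /=; move: m0p; rewrite /m0; lia.
  by rewrite ltz_nat ltn_exp2l// -{2}pE.
rewrite -(ltr_int R) -pmulrn natrX => XP.
have X0 : 0 < (X n t)%:~R :> R by apply: le_lt_trans XP; rewrite exprn_ge0.
have : p.-1%:R * ln 2 <= ln ((X n t)%:~R : R).
  by rewrite mulr_natl -lnXn// ler_ln ?posrE ?exprn_gt0// ltW.
move: plt; have -> : p.+1%:R = p.-1%:R + 1 + 1 :> R by rewrite !natr1 pE.
by clear; lra.
Unshelve. all: by end_near. Qed.

(** Here [p] is rounded up, [2 ^ p.-1 <= n ^ b < 2 ^ p]: at time [n] level [2 ^ p] has not been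
    reached, and the rounding costs one [ln 2]. *)
Lemma growth_le (b : R) : 0 < b ->
  (\forall m \near \oo, ~ has (fun j => (2 ^ m)%N%:Z <= j)
    (hist X (Num.truncn (expR (m%:R * (ln 2 / b)))) t)) ->
  \forall n \near \oo, 1 <= X n t ->
    ln ((X n t)%:~R : R) <= b * ln (n%:R : R) + ln 2.
Proof.
move=> b0 [m0 _ slow].
near=> n => X1.
have n0 : expR (m0%:R * (ln 2 / b)) <= n%:R :> R by near: n; exact: nbhs_infty_ger.
have n1 : 1 <= n%:R :> R by near: n; exact: nbhs_infty_ger.
have n1' : 0 < n%:R :> R := lt_le_trans ltr01 n1.
have bn0 : 0 <= b * ln (n%:R : R) / ln 2 
  by apply: divr_ge0 (ltW ln2_gt0); apply: mulr_ge0 (ltW b0) (ln_ge0 n1).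
set p := (Num.truncn (b * ln (n%:R : R) / ln 2)).+1.
have m0p : (m0 <= p)%N.
  rewrite leqW// truncn_ge_nat//.
  rewrite ler_pdivlMr// -ler_pdivrMl// -ler_expR lnK ?posrE//.
  by apply: le_trans n0; rewrite ler_expR; lra.
have := truncn_itv bn0; rewrite -/p ltr_pdivrMr// ler_pdivlMr// => /andP[ple plt].
have timen : (n <= Num.truncn (expR (p%:R * (ln 2 / b)) : R))%N.
  rewrite truncn_ge_nat ?expR_ge0//.
  rewrite -[n%:R in leLHS]lnK ?posrE// ler_expR mulrA ler_pdivlMr// mulrC.
  exact: ltW.
have Xlt : X n t < (2 ^ p)%N%:Z.
  have /negP := slow p m0p; rewrite -all_predC => /(all_hist_mono timen) h.
  by case: (n) h => [|k] /= => [|/andP[+ _]]; rewrite ?andbT -ltNge.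
have X0 : 0 < (X n t)%:~R :> R by rewrite ltr0z; lia.
move: Xlt; rewrite -(ltr_int R) -pmulrn natrX => XP.
have : ln ((X n t)%:~R : R) <= p%:R * ln 2.
  by rewrite mulr_natl -lnXn// ler_ln ?posrE ?exprn_gt0// ltW.
have -> : p%:R = (Num.truncn (b * ln (n%:R : R) / ln 2))%:R + 1 :> R by rewrite natr1.
move: ple; 
by clear; lra.
Unshelve. all: by end_near. Qed.

End growth.

Lemma ratr_between (R : realType) (x y : R) : x < y -> exists q : rat, x < ratr q < y.
Proof. by move=> /rat_in_itvoo[q]; rewrite in_itv /=; exists q. Qed.

(** Additive constants are absorbed by half of the margin [e], as [ln n] tends to infinity; where
    [x n >= 1] the extended logarithm is the real one. *)
Lemma log_ratio_cvg (R : realType) (x : nat -> int) (a : R) :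
  (\forall n \near \oo, 1 <= x n) ->
  (forall e, 0 < e -> exists K, \forall n \near \oo,
    ln ((x n)%:~R : R) <= (a + e) * ln (n%:R : R) + K) ->
  (forall e, 0 < e -> exists K, \forall n \near \oo,
    (a - e) * ln (n%:R : R) - K <= ln ((x n)%:~R : R)) ->
  (lne ((x n)%:~R : R)%:E / (ln (n%:R : R))%:E)%E @[n --> \oo] --> a%:E.
Proof.
move=> x1 up lo.
have ratioE : \forall n \near \oo,
    (lne ((x n)%:~R : R)%:E / (ln (n%:R : R))%:E)%E = (ln ((x n)%:~R : R) / ln n%:R)%:E.
  near=> n.
  have xn : 1 <= x n by near: n.
  have n2 : (2 <= n)%N by near: n; exact: nbhs_infty_ge.
  rewrite lne_EFin; last by rewrite ltr0z; lia.
  by rewrite inver gt_eqF// ln_gt0// ltr1n.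
apply/fine_cvgP; split.
  by apply: filterS ratioE => n ->.
apply/cvgrPdist_le => e e0.
have e2 : 0 < e / 2 by rewrite divr_gt0.
have [K1 up1] := up _ e2; have [K2 lo2] := lo _ e2.
have big K : \forall n \near \oo, K <= e / 2 * ln (n%:R : R).
  near=> n; have : expR (K / (e / 2)) <= n%:R :> R by near: n; exact: nbhs_infty_ger.
  move=> nK; have n0 : 0 < n%:R :> R := lt_le_trans (expR_gt0 _) nK.
  by move: nK; rewrite -{1}[n%:R]lnK ?posrE// ler_expR ler_pdivrMr// mulrC.
near=> n.
have -> : (fine \o (fun n => lne ((x n)%:~R : R)%:E / (ln (n%:R : R))%:E)%E) n =
    ln ((x n)%:~R : R) / ln n%:R.
  by rewrite /= (near ratioE n).
have n2 : (2 <= n)%N by near: n; exact: nbhs_infty_ge.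
have ln0 : 0 < ln n%:R :> R by rewrite ln_gt0// ltr1n.
have h1 : ln ((x n)%:~R : R) <= (a + e / 2) * ln (n%:R : R) + K1 by near: n.
have h2 : (a - e / 2) * ln (n%:R : R) - K2 <= ln ((x n)%:~R : R) by near: n.
have k1 : K1 <= e / 2 * ln (n%:R : R) by near: n.
have k2 : K2 <= e / 2 * ln (n%:R : R) by near: n.
rewrite ler_norml; apply/andP; split.
  rewrite lerBrDr addrC -lerBrDr opprK ler_pdivrMr//.
  by move: h1 k1; clear; lra.
rewrite lerBlDr addrC -lerBlDr ler_pdivlMr//.
by move: h2 k2; clear; lra.
Unshelve. all: by end_near. Qed.

(** * The limit for a walk in a fixed good environment *)

Section quenched_limit.
Context {d : measure_display} {T : measurableType d} {R : realType}.
Variables (Q : probability T R) (delta : R) (c : int -> R) (X : nat -> T -> int).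
Hypothesis delta_gt0 : 0 < delta.
Hypothesis c_gt0 : forall k, 0 < c k.
Hypothesis walk : quenched_walk Q (omega delta c) X.

(** Rational exponents leave countably many exceptional sets, one for each pair [q < q']: one
    rational describes the environment, the other the walk. The upper bound comes from traps if
    [a < 1] and from [X n <= n] if [a = 1]. *)
Lemma quenched_limit (a : R) : 0 <= a -> a <= 1 ->
  subexponential delta c ->
  (forall q : rat, 0 < ratr q :> R -> ratr q < a -> fast_crossing delta c (ratr q)) ->
  (forall q : rat, a < ratr q -> ratr q < 1 :> R -> has_traps delta c (ratr q)) ->
  {ae Q, forall t,
    (lne ((X n t)%:~R : R)%:E / (ln (n%:R : R))%:E)%E @[n --> \oo] --> a%:E}.
Proof.
move=> a0 a1 sub fast traps.
have aeF : {ae Q, forall t, forall p : rat * rat,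
    0 < ratr p.1 :> R -> ratr p.1 < ratr p.2 :> R -> ratr p.2 < a ->
    \forall m \near \oo, ~ all (fun j => j < (2 ^ m)%N%:Z)
      (hist X (Num.truncn (expR (m%:R * (ln 2 / ratr p.1)) : R)) t)}.
  apply: ae_forall_countable => -[q q'] /=.
  have [/andP[q0 /andP[qq q'a]]|nq] :=
      boolP [&& 0 < ratr q :> R, ratr q < ratr q' :> R & ratr q' < a].
    have := ae_fast c_gt0 walk q0 qq (fast q' (lt_trans q0 qq) q'a).
    by apply: filterS.
  by apply: aeW => t h1 h2 h3; move: nq; rewrite h1 h2 h3.
have aeS : {ae Q, forall t, forall p : rat * rat,
    a < ratr p.1 :> R -> ratr p.1 < ratr p.2 :> R -> ratr p.2 < 1 :> R ->
    \forall m \near \oo, ~ has (fun j => (2 ^ m)%N%:Z <= j)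
      (hist X (Num.truncn (expR (m%:R * (ln 2 / ratr p.2)) : R)) t)}.
  apply: ae_forall_countable => -[q q'] /=.
  have [/andP[q0 /andP[qq q'a]]|nq] :=
      boolP [&& a < ratr q :> R, ratr q < ratr q' :> R & ratr q' < 1 :> R].
    have := ae_slow c_gt0 walk (le_lt_trans a0 q0) qq (traps q q0 (lt_trans qq q'a)).
    by apply: filterS.
  by apply: aeW => t h1 h2 h3; move: nq; rewrite h1 h2 h3.
have aeR := ae_no_return delta_gt0 c_gt0 walk sub.
have aeH := ae_hits delta_gt0 c_gt0 walk sub.
have aeL := ae_linear delta_gt0 walk.
have {}aeF := ae_and aeF (ae_and aeS (ae_and aeR (ae_and aeH aeL))).
apply: filterS aeF => t [F [S [nr [hits lin]]]].
have X1 := eventually_ge1 nr hits.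
apply: (log_ratio_cvg X1) => e e0.
  (* For [a = 1] there is no rational strictly between [a] and [1], and [X n <= n] is used
     instead. *)
  have [a1'|a1'] := eqVneq a 1.
    exists 0; near=> n; have Xn : 1 <= X n t by near: n.
    have n1 : (1 <= n)%N by near: n; exact: nbhs_infty_ge.
    have l0 : 0 <= ln n%:R :> R by rewrite ln_ge0// ler1n.
    rewrite addr0 a1'; apply: (@le_trans _ _ (ln n%:R)).
      by rewrite ler_ln ?posrE ?ltr0z ?ltr0n// -?(ler_int R) ?pmulrn ?ler_int//; lia.
    by rewrite mulrDl mul1r lerDl mulr_ge0// ltW.
  have [q /andP[aq q1]] : exists q : rat, a < ratr q < Num.min 1 (a + e).
    by apply: ratr_between; rewrite lt_min ltrDl e0 andbT lt_neqAle a1' a1.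
  have [q' /andP[qq q'1]] := ratr_between q1.
  move: q'1; rewrite lt_min => /andP[q'1 q'e].
  exists (ln 2).
  have := growth_le (le_lt_trans a0 (lt_trans aq qq)) (S (q, q') aq qq q'1) => H.
  near=> n; have Xn : 1 <= X n t by near: n.
  have n1 : (1 <= n)%N by near: n; exact: nbhs_infty_ge.
  have l0 : 0 <= ln n%:R :> R by rewrite ln_ge0// ler1n.
  have h : 1 <= X n t -> ln ((X n t)%:~R : R) <= ratr q' * ln n%:R + ln 2 by near: n.
  by apply: le_trans (h Xn) _; rewrite lerD2r ler_wpM2r// ltW.
have lX : \forall n \near \oo, 0 <= ln ((X n t)%:~R : R).
  by apply: filterS X1 => n Xn; rewrite ln_ge0// ler1z.
(* If [a - e <= 0] the bound [X n >= 1] is enough; this includes [a = 0]. *)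
have [ae|ae] := leP a e.
  exists 0; near=> n.
  have n1 : (1 <= n)%N by near: n; exact: nbhs_infty_ge.
  have l0 : 0 <= ln n%:R :> R by rewrite ln_ge0// ler1n.
  rewrite subr0; apply: (@le_trans _ _ 0); last by near: n.
  by rewrite mulr_le0_ge0// subr_le0.
have [q /andP[qe qa]] : exists q : rat, a - e < ratr q < a.
  by apply: ratr_between; rewrite gtrBl.
have [q' /andP[qq q'a]] := ratr_between qa.
have q0 : 0 < ratr q :> R by apply: lt_trans qe; rewrite subr_gt0.
exists (2 * ln 2).
have H := growth_ge q0 nr (F (q, q') q0 qq q'a).
near=> n.
have n1 : (1 <= n)%N by near: n; exact: nbhs_infty_ge.
have l0 : 0 <= ln n%:R :> R by rewrite ln_ge0// ler1n.
have h : ratr q * ln n%:R <= ln ((X n t)%:~R : R) + 2 * ln 2 by near: n.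
by rewrite lerBlDr (le_trans _ h)// ler_wpM2r// ltW.
Unshelve. all: by end_near. Qed.

End quenched_limit.

(** * Tails and independence of the conductances *)

Section tail_exponents.
Context {R : realType}.
Implicit Types (p : \bar R) (L s t : R).
Local Open Scope ereal_scope.

(** Here and in the next three lemmas [p = 0] is a separate case: upper bounds are then trivial,
    while for lower bounds [lne 0 = -oo] contradicts the hypothesis. The denominator [- L] is the
    logarithm of a small threshold [expR (- L)]. *)
Lemma lne_div_lt p L s : 0 <= p -> p \is a fin_num -> (0 < L)%R ->
  lne p / L%:E < (- s)%:E -> p <= (expR (- s * L))%:E.
Proof.
case: p => // p p0 _ L0; rewrite lee_fin in p0.
have [->|pn0] := eqVneq p 0%R; first by rewrite lee_fin expR_ge0.
have {pn0}p0 : (0 < p)%R by rewrite lt_neqAle eq_sym pn0.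
rewrite lne_EFin// inver gt_eqF// -EFinM lte_fin lee_fin ltr_pdivrMr// => h.
by rewrite -[p in leLHS]lnK ?posrE// ler_expR ltW.
Qed.

Lemma lne_div_gt p L s : 0 <= p -> p \is a fin_num -> (0 < L)%R ->
  (- s)%:E < lne p / L%:E -> (expR (- s * L))%:E <= p.
Proof.
case: p => // p p0 _ L0; rewrite lee_fin in p0.
have [->|pn0] := eqVneq p 0%R.
  by rewrite le0_lneNy// inver gt_eqF// gt0_mulNye// lte_fin invr_gt0.
have {pn0}p0 : (0 < p)%R by rewrite lt_neqAle eq_sym pn0.
rewrite lne_EFin// inver gt_eqF// -EFinM lte_fin lee_fin ltr_pdivlMr// => h.
by rewrite -[p in leRHS]lnK ?posrE// ler_expR ltW.
Qed.

Lemma lne_div_gt_neg p L s : 0 <= p -> p \is a fin_num -> (0 < L)%R ->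
  s%:E < lne p / (- L)%:E -> p <= (expR (- s * L))%:E.
Proof.
case: p => // p p0 _ L0; rewrite lee_fin in p0.
have [->|pn0] := eqVneq p 0%R; first by rewrite lee_fin expR_ge0.
have {pn0}p0 : (0 < p)%R by rewrite lt_neqAle eq_sym pn0.
have L0' : (- L < 0)%R by rewrite oppr_lt0.
rewrite lne_EFin// inver lt_eqF// -EFinM lte_fin lee_fin ltr_ndivlMr// => h.
by rewrite -[p in leLHS]lnK ?posrE// ler_expR mulNr -mulrN ltW.
Qed.

Lemma lne_div_lt_neg p L s : 0 <= p -> p \is a fin_num -> (0 < L)%R ->
  lne p / (- L)%:E < s%:E -> (expR (- s * L))%:E <= p.
Proof.
case: p => // p p0 _ L0; rewrite lee_fin in p0.
have L0' : (- L < 0)%R by rewrite oppr_lt0.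
have [->|pn0] := eqVneq p 0%R.
  by rewrite le0_lneNy// inver lt_eqF// lt0_mulNye// lte_fin invr_lt0.
have {pn0}p0 : (0 < p)%R by rewrite lt_neqAle eq_sym pn0.
rewrite lne_EFin// inver lt_eqF// -EFinM lte_fin lee_fin ltr_ndivrMr// => h.
by rewrite -[p in leRHS]lnK ?posrE// ler_expR mulNr -mulrN ltW.
Qed.

End tail_exponents.

Section tails.
Context {d : measure_display} {T : measurableType d} {R : realType}.
Variables (P : probability T R) (X : {RV P >-> R}) (alpha : \bar R).
Local Open Scope ereal_scope.

Lemma measurable_preimage (Y : {RV P >-> R}) (B : set R) :
  measurable B -> measurable (Y @^-1` B).
Proof. by move=> mB; rewrite -[_ @^-1` _]setTI; exact: measurable_funP. Qed.

Let measurable_gt M : measurable [set w | (M < X w)%R].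
Proof.
rewrite (_ : [set _ | _] = X @^-1` `]M, +oo[).
  exact: measurable_preimage.
by apply/seteqP; split => w /=; rewrite in_itv /= andbT.
Qed.

Let measurable_lt M : measurable [set w | (X w < M)%R].
Proof.
rewrite (_ : [set _ | _] = X @^-1` `]-oo, M[).
  exact: measurable_preimage.
by apply/seteqP; split => w /=; rewrite in_itv.
Qed.

(** Thresholds are written [expR t] at infinity and [expR (- t)] at zero, so that power tails of [X]
    become exponential tails of its logarithm. *)
Let expR_near (A : R -> Prop) : (\forall M \near +oo%R, A M) ->
  exists t0, (0 < t0)%R /\ forall t, (t0 <= t)%R -> A (expR t).
Proof.
move=> [M0 [_ HM]]; exists (`|M0| + 1)%R; split.
  by rewrite ltr_wpDl.
move=> t tM; apply: HM; apply: lt_le_trans (expR_ge1Dx t).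
by have := ler_norm M0; lra.
Qed.

Let expRN_near (A : R -> Prop) : (\forall e \near 0%R^'+, A e) ->
  exists t0, (0 < t0)%R /\ forall t, (t0 <= t)%R -> A (expR (- t)).
Proof.
move=> [e /= e0 He]; exists (`|ln e| + 1)%R; split; first by rewrite ltr_wpDl.
move=> t tM; apply: He; rewrite /= ?expR_gt0// sub0r normrN gtr0_norm ?expR_gt0//.
rewrite -[e in ltRHS]lnK ?posrE// ltr_expR.
by have := ler_norm (- ln e); rewrite normrN; lra.
Qed.

Section infinity.
Hypothesis tail : (lne (P [set w | (M < X w)%R]) / (ln M)%:E) @[M --> +oo%R]
  --> (- alpha).

Lemma tail_oo_le s : s%:E < alpha -> exists t0, (0 < t0)%R /\ forall t,
  (t0 <= t)%R -> P [set w | (expR t < X w)%R] <= (expR (- s * t))%:E.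
Proof.
move=> sa; have sa' : - alpha < (- s)%:E by rewrite EFinN lteN2.
have /expR_near[t0 [t00 H]] := tail (open_ereal_lt' sa').
exists t0; split => // t t0t; apply: lne_div_lt => //.
- by apply: fin_num_measure; exact: measurable_gt.
- exact: lt_le_trans t0t.
- by have := H t t0t; rewrite /= expRK.
Qed.

Lemma tail_oo_ge s : alpha < s%:E -> exists t0, (0 < t0)%R /\ forall t,
  (t0 <= t)%R -> (expR (- s * t))%:E <= P [set w | (expR t < X w)%R].
Proof.
move=> sa; have sa' : (- s)%:E < - alpha by rewrite EFinN lteN2.
have /expR_near[t0 [t00 H]] := tail (open_ereal_gt' sa').
exists t0; split => // t t0t; apply: lne_div_gt => //.
- by apply: fin_num_measure; exact: measurable_gt.
- exact: lt_le_trans t0t.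
- by have := H t t0t; rewrite /= expRK.
Qed.

End infinity.

Section zero.
Hypothesis tail : (lne (P [set w | (X w < e)%R]) / (ln e)%:E) @[e --> 0%R^'+]
  --> alpha.

Lemma tail_0_le s : s%:E < alpha -> exists t0, (0 < t0)%R /\ forall t,
  (t0 <= t)%R -> P [set w | (X w < expR (- t))%R] <= (expR (- s * t))%:E.
Proof.
move=> sa; have /expRN_near[t0 [t00 H]] := tail (open_ereal_gt' sa).
exists t0; split => // t t0t; apply: lne_div_gt_neg => //.
- by apply: fin_num_measure; exact: measurable_lt.
- exact: lt_le_trans t0t.
- by have := H t t0t; rewrite /= expRK.
Qed.

Lemma tail_0_ge s : alpha < s%:E -> exists t0, (0 < t0)%R /\ forall t,
  (t0 <= t)%R -> (expR (- s * t))%:E <= P [set w | (X w < expR (- t))%R].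
Proof.
move=> sa; have /expRN_near[t0 [t00 H]] := tail (open_ereal_lt' sa).
exists t0; split => // t t0t; apply: lne_div_lt_neg => //.
- by apply: fin_num_measure; exact: measurable_lt.
- exact: lt_le_trans t0t.
- by have := H t t0t; rewrite /= expRK.
Qed.

End zero.

End tails.

(** * Exponential moments from exponential tails *)

Section exponential_moment.
Context {d : measure_display} {T : measurableType d} {R : realType}.
Variable P : probability T R.
Local Open Scope ereal_scope.

(** Where [V > 0], [expR (s * V)] is at most [expr (s * n.+1)] on the layer [n = floor V], and the
    layers have total mean bounded by a geometric series of ratio [expR (s - s')]. *)
Lemma exponential_moment (V : T -> R) (s s' : R) : measurable_fun setT V ->
  (0 < s)%R -> (s < s')%R ->
  (exists t0, forall t, (t0 <= t)%R -> P [set w | (t < V w)%R] <= (expR (- s' * t))%:E) ->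
  \int[P]_w (expR (s * V w))%:E < +oo.
Proof.
move=> mV s0 ss [t0 Ht].
(* The shift by one makes the strict inequality true at [n = floor (V w)] even when [V w] is an
   integer. *)
pose A (n : nat) := [set w | (n%:R - 1 < V w)%R].
have mA n : measurable (A n).
  rewrite (_ : A n = V @^-1` `]n%:R - 1, +oo[%classic)%R; last first.
    by apply/seteqP; split => w /=; rewrite in_itv /= andbT.
  by rewrite -[_ @^-1` _]setTI; exact: mV.
(* [K] pays for the shift in [A] and for the levels below [t0], where only [P <= 1] is known. *)
pose K := expR (s' * (`|t0| + 1)).
have s'0 : (0 < s')%R := lt_trans s0 ss.
have PA n : P (A n) <= (K * expR (- s') ^+ n)%:E.
  rewrite /K -expRM_natr -expRD.
  have [tn|nt] := leP t0 (n%:R - 1)%R.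
    apply: le_trans (Ht _ tn) _; rewrite lee_fin ler_expR.
    by have := mulr_ge0 (ltW s'0) (normr_ge0 t0); lra.
  apply: le_trans (probability_le1 _ (mA n)) _; rewrite lee_fin leNgt expR_lt1 -leNgt.
  have h : (n%:R <= `|t0| + 1)%R by have := ler_norm t0; lra.
  by have := ler_wpM2l (ltW s'0) h; lra.
pose f (n : nat) w : \bar R := (expR (s * n.+1%:R) * \1_(A n) w)%:E.
have f0 n w : 0 <= f n w by rewrite lee_fin mulr_ge0 ?expR_ge0.
have mf n : measurable_fun [set: T] (f n).
  apply/measurable_EFinP; apply: measurable_funM => //; exact: measurable_indic.
have int_f n : \int[P]_w f n w <= (expR s * K * expR (s - s') ^+ n)%:E.
  under eq_integral do rewrite /f EFinM.
  rewrite ge0_integralZl//; last by apply/measurable_EFinP; exact: measurable_indic.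
  rewrite integral_indic// setIT; apply: le_trans (lee_wpmul2l _ (PA n)) _.
    by rewrite lee_fin expR_ge0.
  rewrite -EFinM lee_fin -!expRM_natr -!mulrA mulrCA /K -!expRD ler_expR -natr1.
  by lra.
apply: (@le_lt_trans _ _ (\int[P]_w (1 + \sum_(n <oo) f n w))).
  have mS : measurable_fun setT (fun w => \sum_(n <oo) f n w).
    by apply: ge0_emeasurable_sum.
  apply: ge0_le_integral => //.
  - apply/measurable_EFinP; apply: measurableT_comp => //; exact: measurable_funM.
  - by apply: emeasurable_funD.
  move=> w _; have [V0|V0] := leP (V w) 0%R.
    apply: (@le_trans _ _ 1).
      by rewrite lee_fin expR_le1 mulr_ge0_le0// ltW.
    by rewrite leeDl// nneseries_ge0.
  set n := Num.truncn (V w).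
  have /andP[nV Vn] := truncn_itv (ltW V0); rewrite -/n in nV Vn.
  apply: (@le_trans _ _ (f n w)).
    rewrite /f indicE mem_set ?mulr1; last by rewrite /A /=; lra.
    by rewrite lee_fin ler_expR ler_wpM2l ?ltW.
  apply: (@le_trans _ _ (\sum_(n <oo) f n w)).
    apply: le_trans (nneseries_lim_ge n.+1 _); last by move=> *; exact: f0.
    by rewrite big_nat_recr//= leeDr// sume_ge0.
  by rewrite leeDr.
rewrite ge0_integralD//; last 2 first.
- by move=> w _; exact: nneseries_ge0.
- by apply: ge0_emeasurable_sum.
have -> : \int[P]_w 1 = 1.
  transitivity (1 * P setT); first exact: integral_cst.
  by rewrite mul1e probability_setT.
rewrite integral_nneseries//.
apply: lte_add_pinfty; first exact: ltry.
apply: le_lt_trans (ltry (expR s * K / (1 - expR (s - s')))).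
apply: nneseries_geometric => //.
- by rewrite mulr_ge0 ?expR_ge0.
- by rewrite expR_lt1 subr_lt0.
- by move=> n; exact: integral_ge0.
Qed.

End exponential_moment.

(** * Joint laws of two conductances *)

Section independence.
Context {d : measure_display} {T : measurableType d} {R : realType}.
Variables (P : probability T R) (c : int -> {RV P >-> R}).
Hypothesis c_indep : mutually_independent c.
Hypothesis c_ident : identically_distributed c.
Local Open Scope ereal_scope.

Lemma indep_pair j k (A B : set R) : j != k -> measurable A -> measurable B ->
  P (c j @^-1` A `&` c k @^-1` B) = P (c j @^-1` A) * P (c k @^-1` B).
Proof.
move=> jk mA mB.
have := c_indep (s := [:: j; k]) (B := fun i => if i == j then A else B).
rewrite !big_cons big_nil mule1 eqxx eq_sym (negbTE jk) => <-.
- congr (P _); apply/seteqP; split => w /=.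
    move=> [Aw Bw] i /=; rewrite !inE => /orP[/eqP ->|/eqP ->]; first by rewrite eqxx.
    by rewrite eq_sym (negbTE jk).
  move=> H; split.
    by have := H j; rewrite /= eqxx; apply; rewrite !inE eqxx.
  by have := H k; rewrite /= eq_sym (negbTE jk); apply; rewrite !inE eqxx orbT.
- by rewrite /= inE jk.
- by move=> i; case: ifP.
Qed.

Lemma ident_prob k (B : set R) : measurable B -> P (c k @^-1` B) = P (c 0%R @^-1` B).
Proof. by move=> mB; exact: c_ident. Qed.

Lemma integral_ident k (f : R -> R) : measurable_fun setT f -> (forall x, 0 <= f x)%R ->
  \int[P]_w (f (c k w))%:E = \int[P]_w (f (c 0%R w))%:E.
Proof.
move=> mf f0.
have mf' : measurable_fun setT (EFin \o f) by exact/measurable_EFinP.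
have H i := @ge0_integral_distribution _ _ _ _ _ P (c i) _ mf' (fun y => f0 y).
rewrite -[LHS](H k) -[RHS](H 0%R).
by apply: eq_measure_integral => A mA _; exact: c_ident.
Qed.

(** Agreement on rectangles identifies the joint law of [c j] and [c k] with the product of the
    marginals; Tonelli's theorem then splits the integral. *)
Lemma integral_indep_mul j k (f g : R -> R) : j != k ->
  measurable_fun setT f -> (forall x, 0 <= f x)%R ->
  measurable_fun setT g -> (forall x, 0 <= g x)%R ->
  \int[P]_w (f (c j w) * g (c k w))%:E =
  (\int[P]_w (f (c 0%R w))%:E) * \int[P]_w (g (c 0%R w))%:E.
Proof.
move=> jk mf f0 mg g0.
rewrite -(integral_ident j)// -(integral_ident k)//.
pose mu := distribution P (c j); pose nu := distribution P (c k).
pose phi w := (c j w, c k w).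
have mphi : measurable_fun setT phi by exact: measurable_fun_pair.
pose phi_mixin := isMeasurableFun.Build _ _ _ _ _ mphi.
pose Phi : {mfun T >-> (R * R)%type} := HB.pack phi phi_mixin.
have joint X : measurable X -> (mu \x nu) X = distribution P Phi X.
  move=> mX; apply: product_measure_unique => // A B mA mB.
  exact: indep_pair.
pose F (z : R * R) := (f z.1 * g z.2)%:E.
have mF : measurable_fun setT F.
  by apply/measurable_EFinP; apply: measurable_funM; apply: measurableT_comp.
have F0 z : 0 <= F z by rewrite lee_fin mulr_ge0.
have mf' : measurable_fun setT (EFin \o f) by exact/measurable_EFinP.
have mg' : measurable_fun setT (EFin \o g) by exact/measurable_EFinP.
transitivity (\int[distribution P Phi]_z F z).
  by rewrite ge0_integral_distribution.
transitivity (\int[mu \x nu]_z F z).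
  by apply: eq_measure_integral => A mA _; apply/esym; exact: joint.
rewrite fubini_tonelli1// /fubini_F.
transitivity (\int[mu]_x ((f x)%:E * \int[nu]_y (g y)%:E)).
  by apply: eq_integral => x _; rewrite -ge0_integralZl// => [y _|]; exact: f0 || exact: g0.
rewrite ge0_integralZr//; last by apply: integral_ge0 => y _; rewrite lee_fin.
congr (_ * _).
- exact: (@ge0_integral_distribution _ _ _ _ _ P (c j) _ mf' (fun y => f0 y)).
- exact: (@ge0_integral_distribution _ _ _ _ _ P (c k) _ mg' (fun y => g0 y)).
- by move=> x _; exact: f0.
Qed.

End independence.

(** * Almost sure properties of the environment *)

Section summable_tails.
Context {d : measure_display} {T : measurableType d} {R : realType}.
Variable P : probability T R.
Local Open Scope ereal_scope.

(** At most [Z w / e] indices [n] satisfy [e * n.+1 < Z w]; integrating this count bounds the series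
    by the mean of [Z / e]. *)
Lemma summable_tails (Z : T -> R) (e : R) : (0 < e)%R -> measurable_fun setT Z ->
  (forall w, 0 <= Z w)%R -> \int[P]_w (Z w)%:E < +oo ->
  \sum_(n <oo) P [set w | (e * n.+1%:R < Z w)%R] < +oo.
Proof.
move=> e0 mZ Z0 intZ.
pose A (n : nat) := [set w | (e * n.+1%:R < Z w)%R].
have mA n : measurable (A n).
  rewrite (_ : A n = Z @^-1` `]e * n.+1%:R, +oo[%classic)%R; last first.
    by apply/seteqP; split => w /=; rewrite in_itv /= andbT.
  by rewrite -[_ @^-1` _]setTI; exact: mZ.
have count w N : (\sum_(i < N) \1_(A i) w <= e^-1 * Z w :> R)%R.
  elim: N => [|N IH]; first by rewrite big_ord0 mulr_ge0// invr_ge0 ltW.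
  rewrite big_ord_recr /=; have [Aw|nAw] := pselect (A N w); last first.
    by rewrite indicE memNset// addr0.
  rewrite mulrC ler_pdivlMr//; apply: le_trans (ltW Aw).
  rewrite mulrC ler_pM2l// -[leRHS]natr1; apply: lerD; last first.
    by rewrite indicE; case: (_ \in _).
  apply: le_trans (_ : \sum_(i < N) (1:R) <= _)%R.
    by apply: ler_sum => i _; rewrite indicE; case: (_ \in _).
  by rewrite big_const_ord iter_addr addr0.
apply: (@le_lt_trans _ _ (\int[P]_w ((e^-1)%:E * (Z w)%:E))); last first.
  rewrite ge0_integralZl//; last 3 first.
  - exact/measurable_EFinP.
  - by move=> w _; rewrite lee_fin.
  - by rewrite lee_fin invr_ge0 ltW.
  by rewrite lte_mul_pinfty// lee_fin invr_ge0 ltW.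
apply: nneseries_le_bound => // N.
have -> : \sum_(i < N) P [set w | (e * i.+1%:R < Z w)%R] =
    \int[P]_w (\sum_(i < N) (\1_(A i) w)%:E).
  rewrite ge0_integral_sum//; last by move=> i; apply/measurable_EFinP; exact: measurable_indic.
  by apply: eq_bigr => i _; rewrite integral_indic// setIT.
apply: ge0_le_integral => //.
- by move=> w _; rewrite sume_ge0.
- by apply: emeasurable_sum => i; apply/measurable_EFinP; exact: measurable_indic.
- by apply/measurable_EFinP; apply: measurable_funM.
- by move=> w _; rewrite sumEFin lee_fin count.
Qed.

End summable_tails.

Section typical_range.
Context {d : measure_display} {T : measurableType d} {R : realType}.
Variable P : probability T R.

Lemma measurable_ln_le K : measurable [set x : R | `|ln x| <= K].
Proof.
rewrite (_ : [set _ | _] = (@ln R) @^-1` `[- K, K]).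
  by rewrite -[_ @^-1` _]setTI; exact: measurable_ln.
by apply/seteqP; split => x /=; rewrite in_itv /= /= ler_norml.
Qed.

(** Continuity from below. The event is the range in which one conductance of a pair is kept while
    the other is extreme. *)
Lemma typical_range (X : {RV P >-> R}) :
  exists K, (2^-1%:E <= P (X @^-1` [set x | (`|ln x| <= K)%R]))%E.
Proof.
pose F (n : nat) := X @^-1` [set x | `|ln x| <= n%:R].
have mF n : measurable (F n) by apply: measurable_preimage; exact: measurable_ln_le.
have FT : \bigcup_n F n = setT.
  apply/seteqP; split => // w _; exists (Num.truncn `|ln (X w)|).+1 => //.
  by rewrite /F /=; exact/ltW/truncnS_gt.
have ndF : nondecreasing_seq F.
  move=> n m nm; apply/subsetPset => w; rewrite /F /= => /le_trans; apply.
  by rewrite ler_nat.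
have cv : P \o F @ \oo --> 1%E.
  rewrite -[1%E](@probability_setT _ _ _ P) -FT.
  by apply: nondecreasing_cvg_mu => //; exact: bigcupT_measurable.
have half : (2^-1%:E < 1 :> \bar R)%E by rewrite lte_fin invf_lt1// ltr1n.
have [n _ Hn] := cv _ (open_ereal_gt' half).
by exists n%:R; apply: ltW; exact: (Hn n (leqnn n)).
Qed.

End typical_range.

(** * Growth of the log conductances along the line *)

Section log_integrability.
Context {d : measure_display} {T : measurableType d} {R : realType}.
Variables (P : probability T R) (c : int -> {RV P >-> R}) (delta : R).
Hypothesis c_gt0 : forall k w, 0 < c k w.
Hypothesis c_indep : mutually_independent c.
Hypothesis c_ident : identically_distributed c.
Hypothesis delta_gt0 : 0 < delta.
Hypothesis log_rho : expectation_well_defined P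
  (fun w => ln (rho delta (fun k => c k w) 0)).

Let I (K : R) := [set x : R | `|ln x| <= K].
Let U (r : R) := [set x : R | r < ln x].
Let D (r : R) := [set x : R | ln x < - r].

Let mI K : measurable (I K) := measurable_ln_le K.

Let mU r : measurable (U r).
Proof.
rewrite (_ : U r = (@ln R) @^-1` `]r, +oo[).
  by rewrite -[_ @^-1` _]setTI; exact: measurable_ln.
by apply/seteqP; split => x /=; rewrite in_itv /= andbT.
Qed.

Let mD r : measurable (D r).
Proof.
rewrite (_ : D r = (@ln R) @^-1` `]-oo, - r[).
  by rewrite -[_ @^-1` _]setTI; exact: measurable_ln.
by apply/seteqP; split => x /=; rewrite in_itv.
Qed.

Let typical := typical_range (c 0).

(** By independence [E] has at least the probability of [A] times that of [B], and the latter is at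
    least one half. *)
Let pair_tail j k A B E : j != k -> measurable A -> measurable B -> measurable E ->
  (2^-1%:E <= P (c 0 @^-1` B))%E -> c j @^-1` A `&` c k @^-1` B `<=` E ->
  (P (c 0 @^-1` A) <= 2%:E * P E)%E.
Proof.
move=> jk mA mB mE PB AE.
have : (P (c 0 @^-1` A) * P (c 0 @^-1` B) <= P E)%E.
  rewrite -(ident_prob c_ident j)// -(ident_prob c_ident k)// -indep_pair//.
  apply: le_measure => //; rewrite ?inE//.
  by apply: measurableI; exact: measurable_preimage.
have fA : P (c 0 @^-1` A) \is a fin_num.
  by apply: fin_num_measure; exact: measurable_preimage.
have fB : P (c 0 @^-1` B) \is a fin_num.
  by apply: fin_num_measure; exact: measurable_preimage.
have fE : P E \is a fin_num by exact: fin_num_measure.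
have A0 : (0 <= P (c 0 @^-1` A))%E by [].
move: PB A0; rewrite -(fineK fA) -(fineK fB) -(fineK fE) -!EFinM !lee_fin.
by move: (fine _) (fine _) (fine _) => a b e; nra.
Qed.

Let log_ratioE w : ln (rho delta (fun k => c k w) 0) =
  - 2 * delta + (ln (c (-1) w) - ln (c 0 w)).
Proof.
rewrite rhoE; last by move=> j; exact: c_gt0.
by rewrite lnM ?posrE ?expR_gt0 ?divr_gt0// expRK ln_div ?posrE.
Qed.

(* The tails of [ln (c 0)] are compared with those of the integrable part of
   [ln rho_0], restricting one of the two independent conductances to a typical
   range. *)
Let log_tails : exists Z : T -> R, exists K,
  [/\ measurable_fun setT Z, forall w, 0 <= Z w, (\int[P]_w (Z w)%:E < +oo)%E &
    forall r, 0 <= r ->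
    (P (c 0 @^-1` U (K + r)) <= 2%:E * P [set w | (r < Z w)%R])%E /\
    (P (c 0 @^-1` D (K + r)) <= 2%:E * P [set w | (r < Z w)%R])%E].
Proof.
have [K HK] := typical.
pose Y w := ln (rho delta (fun k => c k w) 0).
have mY : measurable_fun setT Y.
  rewrite (_ : Y = fun w => - 2 * delta + (ln (c (-1) w) - ln (c 0 w))); last first.
    by apply/funext => w; exact: log_ratioE.
  apply: measurable_funD => //; apply: measurable_funB; apply: measurableT_comp => //;
    exact: measurable_ln.
have mgt (Z : T -> R) r : measurable_fun setT Z -> measurable [set w | r < Z w].
  move=> mZ; rewrite (_ : [set _ | _] = Z @^-1` `]r, +oo[); last first.
    by apply/seteqP; split => w /=; rewrite in_itv /= andbT.
  by rewrite -[_ @^-1` _]setTI; exact: mZ.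
have d0 := delta_gt0.
(* Either part of [ln rho_0] controls both tails of [ln (c 0)], since its two conductances enter
   with opposite signs. In the constant, [K] pays for the typical conductance and [2 * delta] for
   the drift. *)
case: log_rho => /integrableP[_].
- pose Z w := Num.max (Y w) 0 => intZ.
  have mZ : measurable_fun setT Z by exact: measurable_maxr.
  have Z0 w : 0 <= Z w by rewrite le_max lexx orbT.
  exists Z, (K + 2 * delta); split => //.
    apply: le_lt_trans intZ; apply: ge0_le_integral => //.
    - by move=> w _; rewrite lee_fin.
    - by apply/measurable_EFinP.
    - apply: measurableT_comp => //; apply: measurable_funepos.
      exact/measurable_EFinP.
    - by move=> w _; rewrite gee0_abs ?funepos_ge0// funeposE /= EFin_max.
  move=> r r0; split.
    apply: (@pair_tail (-1) 0 _ (I K)) => //; first exact: mgt.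
    move=> w; rewrite /U /I /= /Z lt_max /Y log_ratioE => -[h1 /ler_normlP[h2 h3]].
    by apply/orP; left; lra.
  apply: (@pair_tail 0 (-1) _ (I K)) => //; first exact: mgt.
  move=> w; rewrite /D /I /= /Z lt_max /Y log_ratioE => -[h1 /ler_normlP[h2 h3]].
  by apply/orP; left; lra.
- pose Z w := Num.max (- Y w) 0 => intZ.
  have mZ : measurable_fun setT Z.
    by apply: measurable_maxr => //; exact: measurableT_comp.
  have Z0 w : 0 <= Z w by rewrite le_max lexx orbT.
  exists Z, (K + 2 * delta); split => //.
    apply: le_lt_trans intZ; apply: ge0_le_integral => //.
    - by move=> w _; rewrite lee_fin.
    - by apply/measurable_EFinP.
    - apply: measurableT_comp => //; apply: measurable_funeneg.
      exact/measurable_EFinP.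
    - by move=> w _; rewrite gee0_abs ?funeneg_ge0// funenegE /= EFin_max.
  move=> r r0; split.
    apply: (@pair_tail 0 (-1) _ (I K)) => //; first exact: mgt.
    move=> w; rewrite /U /I /= /Z lt_max /Y log_ratioE => -[h1 /ler_normlP[h2 h3]].
    by apply/orP; left; lra.
  apply: (@pair_tail (-1) 0 _ (I K)) => //; first exact: mgt.
  move=> w; rewrite /D /I /= /Z lt_max /Y log_ratioE => -[h1 /ler_normlP[h2 h3]].
  by apply/orP; left; lra.
Qed.

(** Borel-Cantelli with [summable_tails]. Only the common law enters, so one [K] serves every
    enumeration [k] of sites; both half-lines will be used. *)
Let eventually_small : exists K, forall k : nat -> int,
  {ae P, forall w, \forall n \near \oo,
    `|ln (c (k n) w)| <= K + delta / 2 * n.+1%:R}.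
Proof.
have [Z [K [mZ Z0 intZ HZ]]] := log_tails.
exists K => k.
pose E n := c (k n) @^-1` (U (K + delta / 2 * n.+1%:R) `|` D (K + delta / 2 * n.+1%:R)).
have mUD r : measurable (U r `|` D r) by exact: measurableU.
have mE n : measurable (E n) by exact: measurable_preimage.
have d2 : 0 < delta / 2 by rewrite divr_gt0.
have PE n : (P (E n) <= 4%:E * P [set w | (delta / 2 * n.+1%:R < Z w)%R])%E.
  rewrite /E (ident_prob c_ident)// preimage_setU.
  have [h1 h2] := HZ _ (mulr_ge0 (ltW d2) (ler0n R n.+1)).
  apply: (@le_trans _ _ (P (c 0 @^-1` U (K + delta / 2 * n.+1%:R)) +
                         P (c 0 @^-1` D (K + delta / 2 * n.+1%:R)))%E).
    by apply: measureU2; exact: measurable_preimage.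
  apply: le_trans (leeD h1 h2) _; rewrite -ge0_muleDl ?lee_fin// -EFinD.
  by rewrite (_ : 2 + 2 = 4 :> R)//; lra.
have : {ae P, forall w, \forall n \near \oo, ~ E n w}.
  apply: ae_eventually_notin => //.
  apply: le_lt_trans (lee_nneseries _ _) _; [|by move=> n _; exact: PE|] => //.
  rewrite nneseriesZl// lte_mul_pinfty//.
  exact: (summable_tails (P := P) d2).
apply: filterS => w; apply: filterS => n nE.
rewrite ler_norml; apply/andP; split; rewrite leNgt; apply/negP => h; apply: nE.
  by right.
by left.
Qed.

Lemma ae_subexponential : {ae P, forall w, subexponential delta (fun k => c k w)}.
Proof.
have [K HK] := eventually_small.
have := ae_and (HK (fun n => n%:Z)) (HK (fun n => - n%:Z)).
apply: filterS => w [[n1 _ H1] [n2 _ H2]].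
(* [S] absorbs the finitely many sites, on either side, where the eventual bounds do not apply
   yet. *)
pose S := \sum_(i < maxn n1 n2) (`|ln (c i%:Z w)| + `|ln (c (- i%:Z) w)|).
have S0 : 0 <= S by apply: sumr_ge0 => i _; exact: addr_ge0.
exists (`|K| + delta / 2 + S) => k.
have -> : `|k|%:~R = `|k|%N%:R :> R by rewrite -abszE.
set n := `|k|%N.
have d2 : 0 <= delta / 2 * n%:R by rewrite mulr_ge0// divr_ge0// ltW.
have dd : 0 <= delta / 2 by rewrite divr_ge0// ltW.
have KK := ler_norm K; have K0 := normr_ge0 K.
have kE : k = n%:Z \/ k = - n%:Z by rewrite /n; lia.
have [nn|nn] := ltnP n (maxn n1 n2).
  have : `|ln (c n%:Z w)| + `|ln (c (- n%:Z) w)| <= S.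
    rewrite /S (bigD1 (Ordinal nn)) //= lerDl; apply: sumr_ge0 => i _.
    exact: addr_ge0.
  have := normr_ge0 (ln (c n%:Z w)); have := normr_ge0 (ln (c (- n%:Z) w)).
  by case: kE => ->; lra.
move: nn; rewrite geq_max => /andP[nn1 nn2].
case: kE => ->.
  by have := H1 n nn1; rewrite /= -natr1; lra.
by have := H2 n nn2; rewrite /= -natr1; lra.
Qed.

End log_integrability.

(** * Search among independent pairs of neighbouring conductances *)

Section disjoint_pairs.
Context {d : measure_display} {T : measurableType d} {R : realType}.
Variables (P : probability T R) (c : int -> {RV P >-> R}).
Hypothesis c_indep : mutually_independent c.
Hypothesis c_ident : identically_distributed c.
Variables (A B : set R).
Hypotheses (mA : measurable A) (mB : measurable B).

(** Each site belongs to a single pair, so different [j] involve disjoint sets of independent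
    conductances. *)
Let pair (j : nat) : set T := c (2 * j + 1)%N @^-1` A `&` c (2 * j)%N @^-1` B.

Definition no_pair (n : nat) : set T := [set w | forall j, (j < n)%N -> ~ pair j w].

Let rect (s : seq int) (C : int -> set R) : set T :=
  \bigcap_(i in [set` s]) (c i @^-1` C i).

Let mpair j : measurable (pair j).
Proof. by apply: measurableI; exact: measurable_preimage. Qed.

Lemma no_pairS n : no_pair n.+1 = no_pair n `&` ~` pair n.
Proof.
apply/seteqP; split => w /=.
  by move=> H; split => [j jn|]; apply: H => //; exact: leqW.
by move=> [H pn] j; rewrite ltnS leq_eqVlt => /predU1P[->//|]; exact: H.
Qed.

Lemma measurable_no_pair n : measurable (no_pair n).
Proof.
elim: n => [|n IH].
  by rewrite (_ : no_pair 0 = setT)//; apply/seteqP; split.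
by rewrite no_pairS; apply: measurableI => //; exact: measurableC.
Qed.

Let mrect s C : (forall i, measurable (C i)) -> measurable (rect s C).
Proof.
move=> mC; apply: fin_bigcap_measurable => // i _.
exact: measurable_preimage.
Qed.

Local Open Scope ereal_scope.

(* Removing the last pair leaves a rectangle on the remaining coordinates, which
   closes the induction without any general theory of independent families. *)
Let no_pair_rect (p : R) n s C : P (c 0%R @^-1` A) * P (c 0%R @^-1` B) = p%:E ->
  uniq s -> (forall i, i \in s -> (2 * n)%N%:Z <= i)%R ->
  (forall i, measurable (C i)) ->
  P (no_pair n `&` rect s C) = ((1 - p) ^+ n)%:E * P (rect s C).
Proof.
move=> pE; elim: n s C => [|n IH] s C us sn mC.
  rewrite expr0 mul1e (_ : no_pair 0 = setT) ?setTI//.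
  by apply/seteqP; split.
pose s' := [:: (2 * n + 1)%N%:Z, (2 * n)%N%:Z & s].
pose C' i := if i == (2 * n + 1)%N%:Z then A else if i == (2 * n)%N%:Z then B else C i.
have notin (i : int) : (i < (2 * n.+1)%N%:Z)%R -> i \notin s.
  by move=> h; apply/negP => /sn; rewrite leNgt h.
have n1 : (2 * n + 1)%N%:Z \notin s by apply: notin; lia.
have n0 : (2 * n)%N%:Z \notin s by apply: notin; lia.
have n01 : (2 * n)%N%:Z == (2 * n + 1)%N%:Z = false by apply/eqP; lia.
have us' : uniq s' by rewrite /= inE negb_or n1 n0 us eq_sym n01.
have sn' i : i \in s -> ((2 * n)%N%:Z <= i)%R by move=> /sn; lia.
have mC' i : measurable (C' i) by rewrite /C'; case: ifP => // _; case: ifP.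
have CC i : i \in s -> C' i = C i.
  by move=> si; rewrite /C' !ifN//; apply: contraTneq si => ->.
have rectE : rect s' C' = pair n `&` rect s C.
  apply/seteqP; split => w.
    move=> H; split; first split.
    - by have := H (2 * n + 1)%N%:Z; rewrite /= /C' eqxx; apply; rewrite inE eqxx.
    - have := H (2 * n)%N%:Z; rewrite /= /C' eqxx n01; apply.
      by rewrite !inE eqxx orbT.
    - by move=> i /= si; rewrite -(CC i si); apply: H; rewrite /= !inE si !orbT.
  move=> [[h1 h0] H] i; rewrite /= !inE => /or3P[/eqP->|/eqP->|si].
  - by rewrite /C' eqxx.
  - by rewrite /C' n01 eqxx.
  - by rewrite CC//; exact: H.
have PrectE : P (rect s' C') = p%:E * P (rect s C).
  rewrite /rect c_indep// c_indep// /s' !big_cons muleA; congr (_ * _).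
    rewrite {1}/C' eqxx /C' n01 eqxx -pE.
    by rewrite -(ident_prob c_ident (2 * n + 1)%N%:Z)// -(ident_prob c_ident (2 * n)%N%:Z).
  by apply: eq_big_seq => i si; rewrite CC.
have mR : measurable (rect s C) by exact: mrect.
have mN := measurable_no_pair n.
have -> : no_pair n.+1 `&` rect s C =
    (no_pair n `&` rect s C) `\` (no_pair n `&` rect s' C').
  rewrite rectE no_pairS; apply/seteqP; split => w /=; tauto.
have mNR : measurable (no_pair n `&` rect s C) by exact: measurableI.
have mNR' : measurable (no_pair n `&` rect s' C').
  by apply: measurableI => //; exact: mrect.
transitivity (P (no_pair n `&` rect s C) -
   P ((no_pair n `&` rect s C) `&` (no_pair n `&` rect s' C'))).
  apply: measureD => //; rewrite -ge0_fin_numE//; exact: fin_num_measure.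
rewrite [X in _ - P X](_ : _ = no_pair n `&` rect s' C'); last first.
  by rewrite rectE; apply/seteqP; split => w /=; tauto.
rewrite !IH//; last first.
  by move=> i; rewrite !inE => /or3P[/eqP->|/eqP->|/sn']//; lia.
rewrite PrectE.
have fR : P (rect s C) \is a fin_num by exact: fin_num_measure.
by rewrite -(fineK fR) -!EFinM -EFinB exprSr; congr EFin; ring.
Qed.

(** [(1 - p) ^ n <= exp (- q n) <= 1 / (q n)]; this crude bound is still geometric when [n] runs
    through powers of two. *)
Lemma no_pair_le (q : R) n : (0 < q)%R -> (0 < n)%N ->
  q%:E <= P (c 0%R @^-1` A) * P (c 0%R @^-1` B) ->
  P (no_pair n) <= (q * n%:R)^-1%:E.
Proof.
move=> q0 n0 qp.
have fA : P (c 0%R @^-1` A) \is a fin_num.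
  by apply: fin_num_measure; exact: measurable_preimage.
have fB : P (c 0%R @^-1` B) \is a fin_num.
  by apply: fin_num_measure; exact: measurable_preimage.
have [p pE] : exists p, P (c 0%R @^-1` A) * P (c 0%R @^-1` B) = p%:E.
  by exists (fine (P (c 0%R @^-1` A)) * fine (P (c 0%R @^-1` B)))%R;
    rewrite EFinM !fineK.
rewrite pE lee_fin in qp.
have p1 : (p <= 1)%R.
  rewrite -lee_fin -pE -[1%:E]mule1; apply: lee_pmul => //;
    by apply: probability_le1; exact: measurable_preimage.
have -> : no_pair n = no_pair n `&` rect [::] (fun=> setT).
  by rewrite /rect (_ : [set` [::]] = set0) ?bigcap_set0 ?setIT//; apply/seteqP; split.
rewrite (no_pair_rect pE)//.
have -> : rect [::] (fun=> setT) = setT.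
  by rewrite /rect (_ : [set` [::]] = set0) ?bigcap_set0//; apply/seteqP; split.
rewrite probability_setT mule1 lee_fin.
have n0' : (0 < n%:R :> R)%R by rewrite ltr0n.
apply: (@le_trans _ _ (expR (- (q * n%:R)))).
  rewrite -mulNr expRM_natr; apply: lerXn2r; rewrite ?nnegrE ?expR_ge0 ?subr_ge0//.
  by apply: le_trans (expR_ge1Dx _); rewrite lerD2l lerN2.
rewrite expRN lef_pV2 ?posrE ?expR_gt0 ?mulr_gt0//.
by apply: le_trans (expR_ge1Dx _); rewrite lerDr.
Qed.

End disjoint_pairs.

(** * Existence of strong traps *)

Section traps.
Context {d : measure_display} {T : measurableType d} {R : realType}.
Variables (P : probability T R) (c : int -> {RV P >-> R}) (delta : R).
Hypothesis c_gt0 : forall k w, 0 < c k w.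
Hypothesis c_indep : mutually_independent c.
Hypothesis c_ident : identically_distributed c.

Lemma omega_le (a : int -> R) k : (forall j, 0 < a j) ->
  omega delta a k <= expR (2 * delta) * (a k / a (k - 1)).
Proof.
move=> a0; rewrite /omega.
have C0 j : 0 < conductance delta a j by exact: conductance_gt0.
apply: (@le_trans _ _ (conductance delta a k / conductance delta a (k - 1))).
  by rewrite ler_pM2l// lef_pV2 ?posrE ?addr_gt0// lerDl ltW.
have kE : k%:~R = 1 + (k - 1)%:~R :> R by rewrite intrB addrC subrK.
rewrite /conductance kE mulrDr mulr1 expRD.
have e0 := expR_gt0 (2 * delta * (k - 1)%:~R); have a1 := a0 (k - 1).
by rewrite le_eqVlt; apply/orP; left; apply/eqP; field; rewrite !gt_eqF.
Qed.

Let ln2_gt0 : 0 < ln 2 :> R. Proof. by rewrite ln_gt0// ltr1n. Qed.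

(** At [t = m ln 2 / b] a pair succeeds with probability at least of order [2 ^ (- m s / b)], and
    about [2 ^ m] pairs are available; as [s < b], total failure has summable probability. [A t]
    concerns the right conductance of a pair and [B t] the left one, so success makes [omega] of
    order at most [expR (- t)]. *)
Lemma ae_traps_of_pairs (A B : R -> set R) (K K' t0 s b : R) :
  (forall t, measurable (A t)) -> (forall t, measurable (B t)) ->
  0 < K' -> 0 < b -> s < b ->
  (forall t, t0 <= t ->
    ((K' * expR (- s * t))%:E <= P (c 0 @^-1` A t) * P (c 0 @^-1` B t))%E) ->
  (forall t x y, 0 < x -> 0 < y -> A t x -> B t y -> x <= expR (K - t) * y) ->
  {ae P, forall w, has_traps delta (fun k => c k w) b}.
Proof.
move=> mA mB K'0 b0 sb PAB AB.
pose t (m : nat) := m%:R * (ln 2 / b).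
have lb : 0 < ln 2 / b by exact: divr_gt0.
(* The first [2 ^ m.-1] pairs fill exactly the sites from [0] to [2 ^ m - 1]. *)
pose E m := no_pair c (A (t m)) (B (t m)) (2 ^ m.-1).
have mE m : measurable (E m) by exact: measurable_no_pair.
have : {ae P, forall w, \forall m \near \oo, ~ E m w}.
  apply: (ae_eventually_notin_geometric (K := 2 / K') (r := expR (s * (ln 2 / b) - ln 2))).
  - exact: mE.
  - exact: expR_ge0.
  - rewrite expR_lt1 subr_lt0 mulrCA gtr_pMr//.
    by rewrite ltr_pdivrMr// mul1r.
  near=> m.
  have tm : t0 <= t m.
    rewrite -ler_pdivrMr//; near: m; exact: nbhs_infty_ger.
  have m1 : (1 <= m)%N by near: m; exact: nbhs_infty_ge.
  apply: le_trans (no_pair_le c_indep c_ident (mA _) (mB _) _ _ (PAB _ tm)) _.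
  - by rewrite mulr_gt0 ?expR_gt0.
  - by rewrite expn_gt0.
  rewrite lee_fin le_eqVlt; apply/orP; left; apply/eqP.
  have -> : (2 ^ m.-1)%N%:R = expR (m%:R * ln 2) / 2 :> R.
    rewrite expRM_natl lnK ?posrE// -{2}(prednK m1) exprSr natrX mulfK//.
  rewrite -expRM_natl mulrBr expRB /t.
  rewrite (_ : - s * (m%:R * (ln 2 / b)) = - (m%:R * (s * (ln 2 / b)))); last by ring.
  rewrite expRN.
  have e1 := expR_gt0 (m%:R * (s * (ln 2 / b))); have e2 := expR_gt0 (m%:R * ln 2 : R).
  by field; rewrite !gt_eqF.
apply: filterS => w nE; exists (expR (2 * delta) * expR K).
near=> m.
have : ~ E m w by near: m.
have m1 : (1 <= m)%N by near: m; exact: nbhs_infty_ge.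
move=> /existsNP[j /not_implyP[jm /contrapT[/= Ax By]]].
exists (2 * j + 1)%N%:Z; split => //.
  by rewrite ltz_nat -(prednK m1) expnS; lia.
apply: le_trans (omega_le _ _) _; first by move=> k; exact: c_gt0.
rewrite -[leRHS]mulrA ler_pM2l ?expR_gt0// -expRD ler_pdivrMr//.
rewrite (_ : (2 * j + 1)%N%:Z - 1 = (2 * j)%N%:Z); last by lia.
exact: AB Ax By.
Unshelve. all: by end_near. Qed.

(** Whichever exponent lies below [s] supplies the extreme conductance, a small right one or a large
    left one; the other is kept in its typical range at the price of a factor one half. *)
Lemma ae_traps (alpha_0 alpha_oo : \bar R) (b : R)
  (tail_oo : (lne (P [set w | (M < c 0 w)%R]) / (ln M)%:E)%E @[M --> +oo%R]
               --> (- alpha_oo)%E)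
  (tail_0 : (lne (P [set w | (c 0 w < e)%R]) / (ln e)%:E)%E @[e --> 0^'+]
               --> alpha_0) :
  0 < b -> (mine alpha_0 alpha_oo < b%:E)%E ->
  {ae P, forall w, has_traps delta (fun k => c k w) b}.
Proof.
move=> b0 ab.
have [K HK] := typical_range (c 0).
have [s [sa sb]] : exists s, (mine alpha_0 alpha_oo < s%:E)%E /\ s < b.
  case: (mine alpha_0 alpha_oo) ab => [a| |] //.
    rewrite lte_fin => ab; exists ((a + b) / 2); rewrite lte_fin; split; lra.
  by move=> _; exists (b - 1); rewrite ltNyr; split => //; lra.
have mge (x : R) : measurable [set y : R | x < y].
  rewrite (_ : [set _ | _] = `]x, +oo[%classic)//.
  by apply/seteqP; split => y /=; rewrite in_itv /= andbT.
have mle (x : R) : measurable [set y : R | y < x].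
  by rewrite (_ : [set _ | _] = `]-oo, x[%classic).
have half0 : (0 : R) < 2^-1 by rewrite invr_gt0.
move: sa; rewrite gt_min => /orP[/(tail_0_ge tail_0)|/(tail_oo_ge tail_oo)] [t0 [_ H]].
- apply: (@ae_traps_of_pairs (fun t => [set x | x < expR (- t)])
    (fun=> [set x | `|ln x| <= K]) K 2^-1 t0 s b) => //.
  + by move=> t; exact: measurable_ln_le.
  + move=> t tt; rewrite mulrC EFinM; apply: lee_pmul; [|by rewrite lee_fin ltW|exact: H|exact: HK].
    by rewrite lee_fin expR_ge0.
  + move=> t x y x0 y0 /= xt /ler_normlP[yK _].
    apply: le_trans (ltW xt) _; rewrite -[y]lnK ?posrE// -expRD ler_expR; lra.
- apply: (@ae_traps_of_pairs (fun=> [set x | `|ln x| <= K])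
    (fun t => [set x | expR t < x]) K 2^-1 t0 s b) => //.
  + by move=> t; exact: measurable_ln_le.
  + move=> t tt; rewrite EFinM; apply: lee_pmul; [by rewrite lee_fin ltW| |exact: HK|exact: H].
    by rewrite lee_fin expR_ge0.
  + move=> t x y x0 y0 /= /ler_normlP[_ xK].
    rewrite -{1}[y]lnK ?posrE// ltr_expR => ty.
    rewrite -[x]lnK ?posrE// -[y]lnK ?posrE// -expRD ler_expR; lra.
Qed.

End traps.

(** * Crossing times through fractional moments of conductance ratios *)

Section fast_environments.
Context {R : realType}.
Variables (delta : R) (a : int -> R).
Hypothesis a_gt0 : forall k, 0 < a k.

Let ln2_gt0 : 0 < ln 2 :> R. Proof. by rewrite ln_gt0// ltr1n. Qed.

Definition log_conductance_ratio (k i : nat) : R :=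
  - (2 * delta * i.+1%:R) + (ln (a (k%:Z - 1 - i%:Z)) - ln (a k%:Z)).

Lemma conductance_ratioE k i :
  conductance delta a (k%:Z - 1 - i%:Z) / conductance delta a k%:Z =
  expR (log_conductance_ratio k i).
Proof.
rewrite /log_conductance_ratio !expRD expRN lnK ?posrE// expRN lnK ?posrE//.
rewrite /conductance.
have -> : k%:~R = (k%:Z - 1 - i%:Z)%:~R + i.+1%:R :> R.
  by rewrite -[i.+1%:R]/(i.+1%:Z%:~R) -intrD; congr (_%:~R); lia.
rewrite mulrDr expRD invfM.
have e1 := expR_gt0 (2 * delta * (k%:Z - 1 - i%:Z)%:~R).
have e2 := expR_gt0 (2 * delta * i.+1%:R); have a1 := a_gt0 k.
by field; rewrite !gt_eqF.
Qed.

(** The number of terms depends on [M] and is left existential, as the bounds to come are uniform in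
    it. *)
Lemma crossing_timeE M k : exists n, crossing_time delta a M k%:Z =
  1 + 2 * \sum_(i < n) expR (log_conductance_ratio k i).
Proof.
exists (k + M)%N; rewrite /crossing_time /isum; congr (1 + 2 * _).
rewrite (_ : absz _ = (k + M)%N); last by lia.
rewrite mulr_suml (reindex_inj rev_ord_inj) /=; apply: eq_bigr => i _.
rewrite -conductance_ratioE; congr (conductance _ _ _ / _).
by have := ltn_ord i; lia.
Qed.

(* With [s <= 1], a sum of terms is at most the power [1 / s] of the sum of
   their powers [s]. *)
Lemma fast_crossing_of_moments (s b L : R) : 0 < s -> s <= 1 -> 0 < b -> b <= 1 ->
  (forall m (I : nat -> nat), \sum_(k < 2 ^ m) \sum_(i < I k)
     expR (s * log_conductance_ratio k i) <= L * expR (m%:R * (s * (ln 2 / b)))) ->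
  fast_crossing delta a b.
Proof.
move=> s0 s1 b0 b1 HL.
pose L' := `|L| + 1; have L'0 : 0 < L' by rewrite ltr_wpDl.
have LL' : L <= L' by have := ler_norm L; rewrite /L'; lra.
(* The [1] covers the [2 ^ m] constant terms, since [b <= 1] gives [2 ^ m <= 2 ^ (m / b)]; the
   exponential is [L' ^ (1 / s)]. *)
exists (1 + 2 * expR (ln L' / s)) => m M.
pose I (k : nat) : nat := sval (cid (crossing_timeE M k)).
have IE k : crossing_time delta a M k%:Z =
    1 + 2 * \sum_(i < I k) expR (log_conductance_ratio k i).
  exact: (svalP (cid (crossing_timeE M k))).
pose B := L' * expR (m%:R * (s * (ln 2 / b))).
have B0 : 0 < B by rewrite mulr_gt0 ?expR_gt0.
have lnB : ln B = ln L' + m%:R * (s * (ln 2 / b)).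
  by rewrite lnM ?posrE ?expR_gt0// expRK.
have HB : \sum_(k < 2 ^ m) \sum_(i < I k) expR (s * log_conductance_ratio k i) <= B.
  by apply: le_trans (HL m I) _; rewrite ler_wpM2r ?expR_ge0.
have s_1 : 0 <= 1 - s by rewrite subr_ge0.
(* Each term is its power [s] times its power [1 - s]. Its power [s] is at most the total [B], which
   bounds the second factor by [B ^ ((1 - s) / s)]. *)
have term (k : 'I_(2 ^ m)) (i : 'I_(I k)) : expR (log_conductance_ratio k i) <=
    expR (s * log_conductance_ratio k i) * expR ((1 - s) * (ln B / s)).
  rewrite -expRD ler_expR.
  have : expR (s * log_conductance_ratio k i) <= B.
    apply: le_trans HB; rewrite (bigD1 k) //= (bigD1 i) //= -addrA lerDl addr_ge0//.
      by apply: sumr_ge0 => ? _; exact: expR_ge0.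
    by apply: sumr_ge0 => ? _; apply: sumr_ge0 => ? _; exact: expR_ge0.
  rewrite -[X in _ <= X]lnK ?posrE// ler_expR mulrC -ler_pdivlMr// => h.
  by have := ler_wpM2l s_1 h; lra.
have big : \sum_(k < 2 ^ m) \sum_(i < I k) expR (log_conductance_ratio k i) <=
    expR (ln L' / s) * expR (m%:R * (ln 2 / b)).
  apply: (@le_trans _ _ (B * expR ((1 - s) * (ln B / s)))).
    apply: le_trans (_ : _ <= (\sum_(k < 2 ^ m) \sum_(i < I k)
       expR (s * log_conductance_ratio k i)) * expR ((1 - s) * (ln B / s))) _.
      rewrite mulr_suml; apply: ler_sum => k _; rewrite mulr_suml.
      by apply: ler_sum => i _; exact: term.
    by rewrite ler_wpM2r ?expR_ge0.
  rewrite -{1}[B]lnK ?posrE// -!expRD ler_expR lnB.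
  rewrite le_eqVlt; apply/orP; left; apply/eqP; field.
  by rewrite !gt_eqF.
rewrite /isum subr0 /=.
under eq_bigr => k _ do rewrite add0r IE.
rewrite big_split /= -mulr_sumr [leRHS]mulrDl mul1r.
apply: lerD; last first.
  by rewrite -mulrA ler_pM2l.
rewrite sumr_const card_ord natrX -{1}[2]lnK ?posrE// -expRM_natl ler_expR.
rewrite ler_wpM2l// ler_pdivlMr// ler_piMr//; exact: ltW.
Qed.

End fast_environments.

(** * Almost sure bounds on crossing times *)

Section ae_fast_crossing.
Context {d : measure_display} {T : measurableType d} {R : realType}.
Variables (P : probability T R) (c : int -> {RV P >-> R}) (delta : R).
Hypothesis c_gt0 : forall k w, 0 < c k w.
Hypothesis c_indep : mutually_independent c.
Hypothesis c_ident : identically_distributed c.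
Hypothesis delta_gt0 : 0 < delta.

Let ln2_gt0 : 0 < ln 2 :> R. Proof. by rewrite ln_gt0// ltr1n. Qed.

(** By independence the ratio at distance [i.+1] has a moment of order [s] at most [m0 * r ^ i.+1],
    so the moments over the sites below [2 ^ m] sum to order [2 ^ m]. Weighting scale [m] by
    [2 ^ (- m s / b)] gives a series of finite mean, hence finite almost surely. *)
Lemma ae_fast_crossing_of_moments (s b : R) : 0 < b -> b < s -> s <= 1 ->
  (\int[P]_w (expR (s * ln (c 0 w)))%:E < +oo)%E ->
  (\int[P]_w (expR (s * - ln (c 0 w)))%:E < +oo)%E ->
  {ae P, forall w, fast_crossing delta (fun k => c k w) b}.
Proof.
move=> b0 bs s1; have s0 := lt_trans b0 bs.
have idx (k i : nat) : k%:Z - 1 - i%:Z != k%:Z by apply/eqP; lia.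
set m1 := (\int[P]_w _)%E => m1oo; set m2 := (\int[P]_w _)%E => m2oo.
have m10 : (0 <= m1)%E by apply: integral_ge0 => w _; rewrite lee_fin expR_ge0.
have m20 : (0 <= m2)%E by apply: integral_ge0 => w _; rewrite lee_fin expR_ge0.
have [m0 [m00 m0E]] : exists m0, 0 <= m0 /\ (m1 * m2 = m0%:E)%E.
  case: m1 m10 m1oo => [x| |] // x0 _; case: m2 m20 m2oo => [z| |] // z0 _.
  by exists (x * z); split => //; exact: mulr_ge0.
pose y w k i := log_conductance_ratio delta (fun k => c k w) k i.
have mlnc k : measurable_fun setT (fun w => ln (c k w)).
  by apply: measurableT_comp => //; exact: measurable_ln.
have my k i : measurable_fun setT (fun w => (expR (s * y w k i))%:E).
  apply/measurable_EFinP; apply: measurableT_comp => //; apply: measurable_funM => //.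
  by apply: measurable_funD => //; exact: measurable_funB.
pose r : R := expR (- (2 * delta * s)).
have r0 : 0 <= r by exact: expR_ge0.
have r1 : r < 1 by rewrite expR_lt1 oppr_lt0 !mulr_gt0.
pose f (x : R) := expR (s * ln x); pose g (x : R) := expR (s * - ln x).
have mf : measurable_fun setT f.
  by apply: measurableT_comp => //; apply: measurable_funM => //; exact: measurable_ln.
have mg : measurable_fun setT g.
  apply: measurableT_comp => //; apply: measurable_funM => //.
  by apply: measurableT_comp => //; exact: measurable_ln.
have int_y k i : (\int[P]_w (expR (s * y w k i))%:E <= (m0 * r * r ^+ i)%:E)%E.
  have -> : (fun w => (expR (s * y w k i))%:E) = (fun w => (r ^+ i.+1)%:E *
      (f (c (k%:Z - 1 - i%:Z)%R w) * g (c k%:Z w))%:E)%E.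
    apply/funext => w; rewrite -EFinM /f /g /r -expRM_natl -!expRD; congr (expR _)%:E.
    by rewrite /y /log_conductance_ratio; ring.
  rewrite ge0_integralZl//; last 3 first.
  - apply/measurable_EFinP; apply: measurable_funM; exact: measurableT_comp.
  - by move=> w _; rewrite lee_fin mulr_ge0 ?expR_ge0.
  - by rewrite lee_fin exprn_ge0.
  rewrite (integral_indep_mul c_indep c_ident)//; last 2 first.
  - by move=> x; exact: expR_ge0.
  - by move=> x; exact: expR_ge0.
  by rewrite m0E -EFinM lee_fin mulrC exprS mulrA.
pose Y w k : \bar R := (\sum_(i <oo) (expR (s * y w k i))%:E)%E.
have y0 w k i : (0 <= (expR (s * y w k i))%:E)%E by rewrite lee_fin expR_ge0.
have Y0 w k : (0 <= Y w k)%E by exact: nneseries_ge0.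
have mY k : measurable_fun setT (fun w => Y w k).
  by apply: ge0_emeasurable_sum => [i w _ _|i _].
have m0r : 0 <= m0 * r by exact: mulr_ge0.
have int_Y k : (\int[P]_w Y w k <= (m0 * r / (1 - r))%:E)%E.
  rewrite integral_nneseries//.
  apply: (nneseries_geometric m0r r0 r1) => [i|i]; last exact: int_y.
  exact: integral_ge0.
set M1 := m0 * r / (1 - r) in int_Y.
have M10 : 0 <= M1 by rewrite divr_ge0// subr_ge0 ltW.
(* [kap] is [2 ^ (- s / b)]; [b < s] yields [2 * kap < 1], the ratio of the series over scales. *)
pose kap : R := expR (- (s * (ln 2 / b))).
have kap0 : 0 <= kap by exact: expR_ge0.
pose Z w m : \bar R := ((kap ^+ m)%:E * \sum_(k < 2 ^ m) Y w k)%E.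
have S0 w m : (0 <= \sum_(k < 2 ^ m) Y w k)%E by exact: sume_ge0.
have Z0 w m : (0 <= Z w m)%E by rewrite mule_ge0// lee_fin exprn_ge0.
have mS m : measurable_fun setT (fun w => \sum_(k < 2 ^ m) Y w k)%E.
  by apply: emeasurable_sum.
have mZ m : measurable_fun setT (fun w => Z w m).
  exact: measurable_funeM.
have int_Z m : (\int[P]_w Z w m <= (M1 * (2 * kap) ^+ m)%:E)%E.
  rewrite ge0_integralZl//; last by rewrite lee_fin exprn_ge0.
  rewrite ge0_integral_sum//.
  apply: (@le_trans _ _ ((kap ^+ m)%:E * \sum_(k < 2 ^ m) M1%:E)%E).
    apply: lee_wpmul2l; first by rewrite lee_fin exprn_ge0.
    exact: lee_sum.
  rewrite sumEFin -EFinM lee_fin sumr_const card_ord exprMn -[M1 *+ _]mulr_natl natrX.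
  by rewrite le_eqVlt; apply/orP; left; apply/eqP; ring.
have kap2 : 2 * kap < 1.
  rewrite -[2 in X in X < _]lnK ?posrE// -expRD expR_lt1 subr_lt0.
  by rewrite mulrCA ltr_pMr// ltr_pdivlMr// mul1r.
have kap20 : 0 <= 2 * kap by exact: mulr_ge0.
pose W w := (\sum_(m <oo) Z w m)%E.
have mW : measurable_fun setT W.
  by apply: ge0_emeasurable_sum => [m w _ _|m _].
have W0 w : (0 <= W w)%E by exact: nneseries_ge0.
have intW : (\int[P]_w W w < +oo)%E.
  rewrite integral_nneseries//; apply: le_lt_trans (ltry (M1 / (1 - 2 * kap))).
  apply: nneseries_geometric => // m; exact: integral_ge0.
have Wint : P.-integrable setT W.
  apply/integrableP; split => //.
  by under eq_integral => w _ do rewrite gee0_abs//.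
have := integrable_ae measurableT Wint.
apply: filterS => w /(_ Logic.I) Wfin.
(* The finite value of the series bounds all scales at once and serves as the constant [L]. *)
apply: (@fast_crossing_of_moments _ _ _ _ s b (fine (W w))) => //.
  exact/ltW/(lt_le_trans bs).
move=> m I.
have : (Z w m <= W w)%E.
  apply: le_trans (nneseries_lim_ge m.+1 _); last by move=> *; exact: Z0.
  by rewrite big_nat_recr//= leeDr// sume_ge0.
have : (\sum_(k < 2 ^ m) \sum_(i < I k) (expR (s * y w k i))%:E <=
    \sum_(k < 2 ^ m) Y w k)%E.
  apply: lee_sum => k _.
  apply: le_trans (nneseries_lim_ge (I k) _); last by move=> *; exact: y0.
  by rewrite big_mkord.
under eq_bigr => k _ do rewrite sumEFin.
rewrite sumEFin /Z => h1 h2.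
have kapm : kap ^+ m = (expR (m%:R * (s * (ln 2 / b))))^-1.
  by rewrite /kap expRN exprVn expRM_natl.
have h3 : (0 <= (kap ^+ m)%:E)%E by rewrite lee_fin exprn_ge0.
have := le_trans (lee_wpmul2l h3 h1) h2; rewrite -EFinM -(fineK Wfin) lee_fin.
by rewrite -ler_pdivrMr ?expR_gt0// mulrC -kapm.
Qed.

(** With [b < s < s'] below both exponents, tails at rate [s'] give moments of order [s] of the
    conductance and of its inverse. *)
Lemma ae_fast_crossing (alpha_0 alpha_oo : \bar R) (b : R)
  (tail_oo : (lne (P [set w | (M < c 0 w)%R]) / (ln M)%:E)%E @[M --> +oo%R]
               --> (- alpha_oo)%E)
  (tail_0 : (lne (P [set w | (c 0 w < e)%R]) / (ln e)%:E)%E @[e --> 0^'+]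
               --> alpha_0) :
  (mine alpha_0 alpha_oo <= 1)%E ->
  0 < b -> (b%:E < mine alpha_0 alpha_oo)%E ->
  {ae P, forall w, fast_crossing delta (fun k => c k w) b}.
Proof.
move=> a1 b0 ab.
have [s [s' [bs ss s'a s1]]] : exists s s',
    [/\ b < s, s < s', (s'%:E < mine alpha_0 alpha_oo)%E & s <= 1].
  case: (mine alpha_0 alpha_oo) ab a1 => [a| |] //.
  rewrite lte_fin lee_fin => ab a1.
  exists ((2 * b + a) / 3), ((b + 2 * a) / 3); rewrite lte_fin; split; lra.
have s0 : 0 < s := lt_trans b0 bs.
move: s'a; rewrite lt_min => /andP[s'0 s'oo].
have mlnc : measurable_fun setT (fun w => ln (c 0 w)).
  by apply: measurableT_comp => //; exact: measurable_ln.
apply: (@ae_fast_crossing_of_moments s) => //.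
- apply: (@exponential_moment _ _ _ P (fun w => ln (c 0 w)) s s') => //.
  have [t0 [_ H]] := tail_oo_le tail_oo s'oo; exists t0 => t tt.
  apply: le_trans (H t tt); rewrite le_eqVlt; apply/orP; left; apply/eqP; congr (P _).
  by apply/funext => w; rewrite /= -{2}[c 0 w]lnK ?posrE// ltr_expR.
- apply: (@exponential_moment _ _ _ P (fun w => - ln (c 0 w)) s s') => //.
    exact: measurableT_comp.
  have [t0 [_ H]] := tail_0_le tail_0 s'0; exists t0 => t tt.
  apply: le_trans (H t tt); rewrite le_eqVlt; apply/orP; left; apply/eqP; congr (P _).
  by apply/funext => w; rewrite /= -{2}[c 0 w]lnK ?posrE// ltr_expR ltrNr.
Qed.

End ae_fast_crossing.

(** * Combination of the environment estimates with the quenched limit *)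

Theorem theorem1p1 (R : realType) (d : measure_display) (Omega : measurableType d)
    (P : probability Omega R) (c : int -> {RV P >-> R}) (delta : R)
    (alpha_oo alpha_0 : \bar R)
    (c_gt0 : forall k w, 0 < c k w)
    (c_indep : mutually_independent c)
    (c_ident : identically_distributed c)
    (delta_gt0 : 0 < delta)
    (alpha_oo_ge0 : (0 <= alpha_oo)%E)
    (alpha_0_ge0 : (0 <= alpha_0)%E)
    (tail_oo : (lne (P [set w | (M < c 0 w)%R]) / (ln M)%:E)%E @[M --> +oo%R]
                 --> (- alpha_oo)%E)
    (tail_0 : (lne (P [set w | (c 0 w < e)%R]) / (ln e)%:E)%E @[e --> 0^'+]
                 --> alpha_0)
    (alpha_le1 : (mine alpha_0 alpha_oo <= 1)%E)
    (log_rho : expectation_well_defined P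
                 (fun w => ln (rho delta (fun k => c k w) 0))) :
  {ae P, forall w,
    forall (d' : measure_display) (T : measurableType d') (Q : probability T R)
      (X : nat -> T -> int),
      quenched_walk Q (omega delta (fun k => c k w)) X ->
      {ae Q, forall t,
        (lne ((X n t)%:~R : R)%:E / (ln (n%:R : R))%:E)%E @[n --> \oo]
          --> mine alpha_0 alpha_oo}}.
Proof.
have [a [aE a0 a1]] : exists a : R,
    [/\ mine alpha_0 alpha_oo = a%:E, 0 <= a & a <= 1].
  have : (0 <= mine alpha_0 alpha_oo)%E by rewrite le_min alpha_0_ge0.
  case: (mine alpha_0 alpha_oo) alpha_le1 => [a| |] //.
  by rewrite !lee_fin => a1 a0; exists a.
have sub := ae_subexponential c_gt0 c_indep c_ident delta_gt0 log_rho.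
have fast : {ae P, forall w, forall q : rat, 0 < ratr q :> R -> ratr q < a ->
    fast_crossing delta (fun k => c k w) (ratr q)}.
  apply: ae_forall_countable => q.
  have [/andP[q0 qa]|nq] := boolP ((0 < ratr q :> R) && (ratr q < a)); last first.
    by apply: aeW => w q0 qa; move: nq; rewrite q0 qa.
  have qa' : ((ratr q)%:E < mine alpha_0 alpha_oo)%E by rewrite aE lte_fin.
  have := ae_fast_crossing c_gt0 c_indep c_ident delta_gt0 tail_oo tail_0 alpha_le1 q0 qa'.
  by apply: filterS.
have traps : {ae P, forall w, forall q : rat, a < ratr q -> ratr q < 1 :> R ->
    has_traps delta (fun k => c k w) (ratr q)}.
  apply: ae_forall_countable => q.
  have [aq|nq] := boolP (a < ratr q); last by apply: aeW.
  have aq' : (mine alpha_0 alpha_oo < (ratr q)%:E)%E by rewrite aE lte_fin.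
  have := ae_traps delta c_gt0 c_indep c_ident tail_oo tail_0 (le_lt_trans a0 aq) aq'.
  by apply: filterS.
have good := ae_and sub (ae_and fast traps).
(* The null set of environments is fixed before the probability space of the walk, so it serves all
   realisations of the walk at once. *)
apply: filterS good => w [sub_w [fast_w traps_w]] d' T Q X walk.
rewrite aE.
exact: (@quenched_limit _ _ _ Q delta (fun k => c k w) X delta_gt0
  (fun k => c_gt0 k w) walk a a0 a1 sub_w fast_w traps_w).
Qed.
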